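(* Let $R$ be a commutative artin ring, $\mathcal{C}$ a dualizing $R$-variety, $P=\mathrm{Hom}_{\mathcal{C}}(C,-)\in\mathrm{mod}(\mathcal{C})$ and $\mathcal{I}=\mathrm{Tr}_{P}\mathcal{C}$. Let $1\leq k\leq\infty$. Then $\mathcal{I}$ is $(k+1)$-idempotent if and only if $\mathcal{I}(C',-)\in\mathbb{P}_{k}$ for all $C'\in\mathcal{C}$.
   Context: A Hom-finite $R$-variety is a small additive category in which idempotents split, whose Hom-sets are finitely generated $R$-modules with $R$-bilinear composition. $\mathrm{Mod}(\mathcal{C})$ is the category of additive functors $\mathcal{C}\to\mathbf{Ab}$ and $\mathrm{mod}(\mathcal{C})$ its full subcategory of finitely presented functors. With $E$ the injective envelope of $R/\mathrm{rad}(R)$, put $\mathbb{D}_{\mathcal{C}}(M)(C)=\mathrm{Hom}_R(M(C),E)$ for functors with finitely generated values; $\mathcal{C}$ is dualizing if $\mathbb{D}_{\mathcal{C}}$ induces a duality between $\mathrm{mod}(\mathcal{C})$ and $\mathrm{mod}(\mathcal{C}^{op})$. The trace ideal $\mathrm{Tr}_P\mathcal{C}$ is given by $(\mathrm{Tr}_P\mathcal{C})(A,B)=\mathrm{Tr}_P(\mathrm{Hom}_{\mathcal{C}}(A,-))(B)$, where $\mathrm{Tr}_P(N)\subseteq N$ is the sum of the images of all morphisms $P\to N$. For an ideal $\mathcal{I}$, $\mathcal{C}/\mathcal{I}$ is the quotient category (same objects, Hom-sets $\mathrm{Hom}_{\mathcal{C}}(A,B)/\mathcal{I}(A,B)$),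 $\pi:\mathcal{C}\to\mathcal{C}/\mathcal{I}$ the canonical functor, $\pi_{\ast}(F)=F\circ\pi$. $\mathcal{I}$ is $n$-idempotent if the morphism $\mathrm{Ext}^{i}_{\mathrm{Mod}(\mathcal{C}/\mathcal{I})}(F,F')\to\mathrm{Ext}^{i}_{\mathrm{Mod}(\mathcal{C})}(\pi_{\ast}F,\pi_{\ast}F')$ induced by the exact functor $\pi_{\ast}$ is an isomorphism for all $F,F'\in\mathrm{Mod}(\mathcal{C}/\mathcal{I})$ and $0\leq i\leq n$; for $n=\infty$ (i.e. $k=\infty$) this means for all $i\geq0$ (strongly idempotent). $\mathrm{add}(P)$ is the class of direct summands of finite direct sums of copies of $P$. $\mathbb{P}_k$ ($0\leq k\leq\infty$) is the full subcategory of $\mathrm{mod}(\mathcal{C})$ of those $X$ having a projective resolution $\cdots\to P_n\to\cdots\to P_1\to P_0\to X\to0$ with $P_i\in\mathrm{add}(P)$ for $0\leq i\leq k$ (for all $i\ge0$ if $k=\infty$). *)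

(* Defs.v *)
From HB Require Import structures.
From mathcomp Require Import all_boot all_algebra.
From mathcomp Require Import boolp.

Set Implicit Arguments.
Unset Strict Implicit.
Unset Printing Implicit Defensive.

Import GRing.Theory.
Local Open Scope ring_scope.
Local Open Scope quotient_scope.
#[local] Obligation Tactic := idtac.

(* Bounds in {0, 1, 2, ...} together with infinity, which is [None]. *)
Definition enat := option nat.
Definition leqe (i : nat) (k : enat) : bool :=
  if k is Some m then (i <= m)%N else true.
Definition esucc (k : enat) : enat := omap succn k.

Section SubObjects.
Variables (V : zmodType) (S : zmodClosed V).

Definition subz : Type := {x : V | x \in S}.

HB.instance Definition _ := SubChoice.on subz.
HB.instance Definition _ := [SubChoice_isSubZmodule of subz by <:].

End SubObjects.

Section LinearMaps.
Variables (R : comPzRingType) (U V : lmodType R).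

Definition lin : Type := {linear U -> V}.

Lemma lin_ext (f g : {linear U -> V}) : f =1 g -> f = g.
Proof.
move=> fg; have {fg} := funext fg.
case: f => f [[f1] [f2]]; case: g => g [[g1] [g2]] /= e.
case: _ / e f1 f2 g1 g2 => f1 f2 g1 g2.
by rewrite (Prop_irrelevance f1 g1) (Prop_irrelevance f2 g2).
Qed.

HB.instance Definition _ := gen_eqMixin lin.
HB.instance Definition _ := gen_choiceMixin lin.

Definition lin_zero : lin := \0 : {linear U -> V}.
Definition lin_opp (f : lin) : lin := (\- (f : {linear U -> V})) : {linear U -> V}.
Definition lin_add (f g : lin) : lin :=
  ((f : {linear U -> V}) \+ (g : {linear U -> V})) : {linear U -> V}.

Lemma lin_addA : associative lin_add.
Proof. by move=> f g h; apply: lin_ext => x /=; rewrite addrA. Qed.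
Lemma lin_addC : commutative lin_add.
Proof. by move=> f g; apply: lin_ext => x /=; rewrite addrC. Qed.
Lemma lin_add0 : left_id lin_zero lin_add.
Proof. by move=> f; apply: lin_ext => x /=; rewrite add0r. Qed.
Lemma lin_addN : left_inverse lin_zero lin_opp lin_add.
Proof. by move=> f; apply: lin_ext => x /=; rewrite addNr. Qed.

HB.instance Definition _ :=
  GRing.isZmodule.Build lin lin_addA lin_addC lin_add0 lin_addN.

End LinearMaps.

Section QuotientModule.
Variables (R : comPzRingType) (V : lmodType R) (S : {pred V}).
Hypothesis S_submod : submod_closed S.

(* [S], tagged with the proof of its closure properties. *)
Definition submod_pred of submod_closed S : {pred V} := S.

HB.instance Definition _ := GRing.isZmodClosed.Build V
  (submod_pred S_submod) (GRing.submod_closedB S_submod).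

Definition quotmod : Type := {ideal_quot (submod_pred S_submod)}.

HB.instance Definition _ := GRing.Zmodule.on quotmod.

Definition quotmod_pi (x : V) : quotmod := \pi_({ideal_quot (submod_pred S_submod)}) x.
Definition quotmod_scale (r : R) (x : quotmod) : quotmod :=
  quotmod_pi (r *: repr x).

Lemma quotmod_piE (x y : V) : quotmod_pi x = quotmod_pi y <-> x - y \in S.
Proof.
rewrite /quotmod_pi; split=> [/eqP|h]; first by rewrite -Quotient.idealrBE.
by apply/eqP; rewrite -Quotient.idealrBE.
Qed.

Lemma quotmod_piP (x : quotmod) : exists y, x = quotmod_pi y.
Proof. by exists (repr x); rewrite /quotmod_pi reprK. Qed.

Lemma quotmod_piB : zmod_morphism quotmod_pi.
Proof. by move=> x y; rewrite /quotmod_pi raddfB. Qed.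

HB.instance Definition _ :=
  GRing.isZmodMorphism.Build V quotmod quotmod_pi quotmod_piB.

Lemma quotmod_scale_pi r x : quotmod_scale r (quotmod_pi x) = quotmod_pi (r *: x).
Proof.
apply/quotmod_piE; rewrite -scalerBr.
have [S0 SZ] := S_submod; rewrite -[_ *: _]addr0 SZ //.
by apply/quotmod_piE; rewrite /quotmod_pi reprK.
Qed.

Lemma quotmod_scaleA a b v :
  quotmod_scale a (quotmod_scale b v) = quotmod_scale (a * b) v.
Proof. by have [w ->] := quotmod_piP v; rewrite !quotmod_scale_pi scalerA. Qed.
Lemma quotmod_scale1 : left_id 1 quotmod_scale.
Proof. by move=> v; have [w ->] := quotmod_piP v; rewrite quotmod_scale_pi scale1r. Qed.
Lemma quotmod_scaleDr : right_distributive quotmod_scale +%R.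
Proof.
move=> a v w; have [x ->] := quotmod_piP v; have [y ->] := quotmod_piP w.
by rewrite -raddfD !quotmod_scale_pi scalerDr raddfD.
Qed.
Lemma quotmod_scaleDl v : {morph quotmod_scale^~ v : a b / a + b}.
Proof.
move=> a b; have [x ->] := quotmod_piP v.
by rewrite !quotmod_scale_pi scalerDl raddfD.
Qed.

HB.instance Definition _ := GRing.Zmodule_isLmodule.Build R quotmod
  quotmod_scaleA quotmod_scale1 quotmod_scaleDr quotmod_scaleDl.

End QuotientModule.

Section RingTheory.
Variable R : comPzRingType.

Definition maximal_ideal (m : {pred R^o}) : Prop :=
  [/\ submod_closed m, ~~ (1 \in m) &
      forall J : {pred R^o}, submod_closed J -> {subset m <= J} ->
        ~~ (1 \in J) -> J =i m].

Definition artinian : Prop :=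
  forall J : nat -> {pred R^o}, (forall n, submod_closed (J n)) ->
    (forall n, {subset J n.+1 <= J n}) ->
  exists N, forall n, (N <= n)%N -> J n =i J N.

(* The Jacobson radical. *)
Definition rad : {pred R^o} :=
  [pred x | `[< forall m, maximal_ideal m -> x \in m >]].

Lemma rad_submod : submod_closed rad.
Proof.
split=> [|a x y]; first by apply/asboolP => m [] [].
move=> /asboolP hx /asboolP hy; apply/asboolP => m hm.
by have [[_ hl] _ _] := hm; apply: hl; [apply: hx | apply: hy].
Qed.

(* R / rad(R) *)
Definition ring_top : lmodType R := quotmod rad_submod.

Definition fin_gen (V : lmodType R) : Prop :=
  exists (n : nat) (g : 'I_n -> V),
    forall x, exists r : 'I_n -> R, x = \sum_i r i *: g i.

Definition injective_module (E : lmodType R) : Prop :=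
  forall (M N : lmodType R) (i : {linear M -> N}) (f : {linear M -> E}),
    injective i -> exists g : {linear N -> E}, forall x, g (i x) = f x.

Definition essential (M E : lmodType R) (j : {linear M -> E}) : Prop :=
  forall S : {pred E}, submod_closed S -> (exists2 y, y \in S & y != 0) ->
  exists2 x, j x \in S & j x != 0.

Definition injective_envelope (M E : lmodType R) (j : {linear M -> E}) : Prop :=
  [/\ injective_module E, injective j & essential j].

End RingTheory.

Record preadditive := Preadditive {
  ob :> Type;
  hom : ob -> ob -> zmodType;
  idm : forall a, hom a a;
  comp : forall a b c, hom b c -> hom a b -> hom a c;
  compA : forall a b c d (h : hom c d) (g : hom b c) (f : hom a b),
    comp h (comp g f) = comp (comp h g) f;
  comp1m : forall a b (f : hom a b), comp (idm b) f = f;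
  compm1 : forall a b (f : hom a b), comp f (idm a) = f;
  compBl : forall a b c (f : hom a b) (g h : hom b c),
    comp (g - h) f = comp g f - comp h f;
  compBr : forall a b c (g : hom b c) (f h : hom a b),
    comp g (f - h) = comp g f - comp g h
}.
Arguments hom {_} a b.
Arguments idm {_} a.
Arguments comp {_ _ _ _} g f.
Notation "g \oc f" := (comp g f) (at level 40, left associativity).

Record addfun (C D : preadditive) := AddFun {
  fo :> C -> D;
  fa : forall a b, hom a b -> hom (fo a) (fo b);
  fa_add : forall a b (f g : hom a b), fa (f - g) = fa f - fa g;
  fa_id : forall a, fa (idm a) = idm (fo a);
  fa_comp : forall a b c (g : hom b c) (f : hom a b), fa (g \oc f) = fa g \oc fa f
}.
Arguments fa {_ _} _ {_ _} f.

(* The objects of Mod(C): additive functors from C to abelian groups. *)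
Record functor (C : preadditive) := Functor {
  fob :> C -> zmodType;
  fmap : forall a b, hom a b -> fob a -> fob b;
  fmap_add : forall a b (f : hom a b), zmod_morphism (fmap f);
  fmap_addl : forall a b (f g : hom a b) x, fmap (f - g) x = fmap f x - fmap g x;
  fmap_id : forall a x, fmap (idm a) x = x;
  fmap_comp : forall a b c (g : hom b c) (f : hom a b) x,
    fmap (g \oc f) x = fmap g (fmap f x)
}.
Arguments fmap {_} _ {_ _} f x.

Record nat_trans (C : preadditive) (F G : functor C) := NatTrans {
  nt :> forall a, F a -> G a;
  nt_add : forall a, zmod_morphism (@nt a);
  nt_nat : forall a b (f : hom a b) x, nt (fmap F f x) = fmap G f (nt x)
}.
Arguments nt {_ _ _} _ a x.

HB.instance Definition _ C (F : functor C) a b (f : hom a b) :=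
  GRing.isZmodMorphism.Build (F a) (F b) (fmap F f)
    (@fmap_add C F a b f).
HB.instance Definition _ C (F G : functor C) (u : nat_trans F G) a :=
  GRing.isZmodMorphism.Build (F a) (G a) (nt u a) (@nt_add C F G u a).

Section NatTransZmod.
Variables (C : preadditive) (F G : functor C).
Implicit Types u v w : nat_trans F G.

Lemma nt_ext u v : (forall a x, u a x = v a x) -> u = v.
Proof.
case: u => u u1 u2; case: v => v v1 v2 /= e.
have {}e : u = v by apply: functional_extensionality_dep => a; apply: funext.
case: _ / e v1 v2 => v1 v2.
by rewrite (Prop_irrelevance u1 v1) (Prop_irrelevance u2 v2).
Qed.

HB.instance Definition _ := gen_eqMixin (nat_trans F G).
HB.instance Definition _ := gen_choiceMixin (nat_trans F G).

Program Definition nt_zero : nat_trans F G := @NatTrans _ F G (fun _ _ => 0) _ _.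
Next Obligation. by move=> a x y; rewrite /= subr0. Qed.
Next Obligation. by move=> a b f x; rewrite /= raddf0. Qed.

Program Definition nt_opp u : nat_trans F G :=
  @NatTrans _ F G (fun a x => - u a x) _ _.
Next Obligation. by move=> u a x y; rewrite /= raddfB opprB opprK addrC. Qed.
Next Obligation. by move=> u a b f x; rewrite /= nt_nat raddfN. Qed.

Program Definition nt_plus u v : nat_trans F G :=
  @NatTrans _ F G (fun a x => u a x + v a x) _ _.
Next Obligation. by move=> u v a x y; rewrite /= !raddfB opprD addrACA. Qed.
Next Obligation. by move=> u v a b f x; rewrite /= !nt_nat raddfD. Qed.

Lemma nt_plusA : associative nt_plus.
Proof. by move=> u v w; apply: nt_ext => a x /=; rewrite addrA. Qed.
Lemma nt_plusC : commutative nt_plus.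
Proof. by move=> u v; apply: nt_ext => a x /=; rewrite addrC. Qed.
Lemma nt_plus0 : left_id nt_zero nt_plus.
Proof. by move=> u; apply: nt_ext => a x /=; rewrite add0r. Qed.
Lemma nt_plusN : left_inverse nt_zero nt_opp nt_plus.
Proof. by move=> u; apply: nt_ext => a x /=; rewrite addNr. Qed.

HB.instance Definition _ :=
  GRing.isZmodule.Build (nat_trans F G) nt_plusA nt_plusC nt_plus0 nt_plusN.

End NatTransZmod.

Program Definition nt_id C (F : functor C) : nat_trans F F :=
  @NatTrans _ F F (fun _ x => x) _ _.
Next Obligation. by []. Qed.
Next Obligation. by []. Qed.

Program Definition nt_comp C (F G H : functor C) (v : nat_trans G H)
    (u : nat_trans F G) : nat_trans F H :=
  @NatTrans _ F H (fun a x => v a (u a x)) _ _.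
Next Obligation. by move=> C F G H v u a x y; rewrite /= !raddfB. Qed.
Next Obligation. by move=> C F G H v u a b f x; rewrite /= !nt_nat. Qed.
Notation "v \on u" := (nt_comp v u) (at level 40, left associativity).

Definition nt_iso C (F G : functor C) : Prop :=
  exists (u : nat_trans F G) (v : nat_trans G F),
    v \on u = nt_id F /\ u \on v = nt_id G.

(* Hom(c, -) *)
Program Definition rep (C : preadditive) (c : C) : functor C :=
  @Functor C (fun a => hom c a) (fun a b f x => f \oc x) _ _ _ _.
Next Obligation. by move=> C c a b f; apply: compBr. Qed.
Next Obligation. by move=> C c a b f g x; apply: compBl. Qed.
Next Obligation. by move=> C c a x; apply: comp1m. Qed.
Next Obligation. by move=> C c a b d g f x; rewrite /= compA. Qed.

Section Restriction.
Variables (C D : preadditive) (T : addfun C D).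

Program Definition restr (F : functor D) : functor C :=
  @Functor C (fun a => F (T a)) (fun a b f x => fmap F (fa T f) x) _ _ _ _.
Next Obligation. by move=> F a b f; apply: fmap_add. Qed.
Next Obligation. by move=> F a b f g x; rewrite /= fa_add fmap_addl. Qed.
Next Obligation. by move=> F a x; rewrite /= fa_id fmap_id. Qed.
Next Obligation. by move=> F a b c g f x; rewrite /= fa_comp fmap_comp. Qed.

Program Definition restr_nt (F G : functor D) (u : nat_trans F G) :
    nat_trans (restr F) (restr G) :=
  @NatTrans _ (restr F) (restr G) (fun a x => u (T a) x) _ _.
Next Obligation. by move=> F G u a; apply: (@nt_add _ _ _ u (T a)). Qed.
Next Obligation. by move=> F G u a b f x; apply: (nt_nat u). Qed.

End Restriction.

Section HomologicalNotions.
Variable C : preadditive.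
Implicit Types F G H M N P X : functor C.

(* Epimorphisms, kernels and images in Mod(C) are computed objectwise. *)
Definition nt_epi F G (u : nat_trans F G) : Prop :=
  forall a y, exists x, u a x = y.
Definition exact_at F G H (u : nat_trans F G) (v : nat_trans G H) : Prop :=
  forall a y, v a y = 0 <-> exists x, u a x = y.

Definition projective P : Prop :=
  forall M N (e : nat_trans M N), nt_epi e ->
  forall f : nat_trans P N, exists g : nat_trans P M, e \on g = f.

(* Over an additive category finite direct sums of representables are
   representable, so a presentation by single representables is enough. *)
Definition fin_pres M : Prop :=
  exists (a b : C) (d : nat_trans (rep b) (rep a)) (e : nat_trans (rep a) M),
    nt_epi e /\ exact_at d e.

Record projres X := ProjRes {
  pr :> nat -> functor C;
  prd : forall i, nat_trans (pr i.+1) (pr i);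
  aug : nat_trans (pr 0%N) X;
  pr_proj : forall i, projective (pr i);
  pr_epi : nt_epi aug;
  pr_exact0 : exact_at (prd 0%N) aug;
  pr_exact : forall i, exact_at (prd i.+1) (prd i)
}.

End HomologicalNotions.

Section Cocycles.
Variables (C : preadditive) (X : functor C) (Pr : projres X) (Y : functor C) (i : nat).

Definition cocycle : {pred nat_trans (Pr i) Y} := [pred f | f \on prd Pr i == 0].

Lemma cocycle_closed : zmod_closed cocycle.
Proof.
split=> [|f g]; first by apply/eqP; apply: nt_ext.
rewrite !inE => /eqP hf /eqP hg; apply/eqP; apply: nt_ext => a x /=.
have /= e1 := congr1 (fun u : nat_trans _ _ => u a x) hf.
have /= e2 := congr1 (fun u : nat_trans _ _ => u a x) hg.
by rewrite e1 e2 oppr0 addr0.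
Qed.

HB.instance Definition _ := GRing.isZmodClosed.Build _ cocycle cocycle_closed.

End Cocycles.
Arguments cocycle {C X} Pr Y i _.

Definition is_coboundary C (X : functor C) (Pr : projres X) (Y : functor C) (i : nat) :
    nat_trans (Pr i) Y -> Prop :=
  match i with
  | 0%N => fun f => f = 0
  | j.+1 => fun f => exists g : nat_trans (Pr j) Y, f = g \on prd Pr j
  end.

Section Cohomology.
Variables (C : preadditive) (X : functor C) (Pr : projres X) (Y : functor C) (i : nat).

Definition coboundary : {pred subz (cocycle Pr Y i)} :=
  [pred f | `[< is_coboundary (val f) >]].

Lemma coboundary_closed : zmod_closed coboundary.
Proof.
rewrite /coboundary; case: i => [|j]; split=> [|f g]; rewrite ?inE.
- exact/asboolP.
- by move=> /asboolP/= hf /asboolP/= hg; apply/asboolP; rewrite /= hf hg subr0.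
- by apply/asboolP; exists 0; apply: nt_ext.
move=> /asboolP[u hu] /asboolP[v hv]; apply/asboolP; exists (u - v).
by rewrite raddfB /= hu hv; apply: nt_ext.
Qed.

HB.instance Definition _ := GRing.isZmodClosed.Build _ coboundary coboundary_closed.

(* Ext^i(X, Y) as the i-th cohomology of Hom(Pr, Y). *)
Definition Ext : zmodType := {ideal_quot coboundary}.

Definition Ext_class (f : subz (cocycle Pr Y i)) : Ext :=
  \pi_({ideal_quot coboundary}) f.

Lemma Ext_classE f g : Ext_class f = Ext_class g <-> f - g \in coboundary.
Proof.
rewrite /Ext_class Quotient.idealrBE.
by split=> [/eqP|/eqP].
Qed.

Lemma Ext_classP (x : Ext) : exists f, x = Ext_class f.
Proof. by exists (repr x); rewrite /Ext_class reprK. Qed.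

Lemma Ext_classB : zmod_morphism Ext_class.
Proof. by move=> f g; rewrite /Ext_class raddfB. Qed.

End Cohomology.
Arguments coboundary {C X} Pr Y i _.

Section ExtMap.
Variables (C D : preadditive) (T : addfun C D) (X : functor D).

(* A chain map over the identity of [restr T X], from a projective resolution
   of [restr T X] to the exact complex obtained by restricting [Pr]. *)
Record comparison (Pr : projres X) (Q : projres (restr T X)) := Comparison {
  cmp :> forall i, nat_trans (Q i) (restr T (Pr i));
  cmp_d : forall i, cmp i \on prd Q i = restr_nt T (prd Pr i) \on cmp i.+1;
  cmp_aug : restr_nt T (aug Pr) \on cmp 0%N = aug Q
}.

Variables (Pr : projres X) (Q : projres (restr T X)) (phi : comparison Pr Q).
Variables (Y : functor D) (i : nat).

Lemma transport_cocycle (f : subz (cocycle Pr Y i)) :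
  restr_nt T (val f) \on phi i \in cocycle Q (restr T Y) i.
Proof.
case: f => f /= /eqP hf; apply/eqP; apply: nt_ext => a x /=.
have /= -> := congr1 (fun u : nat_trans _ _ => u a x) (cmp_d phi i).
exact: (congr1 (fun u : nat_trans _ _ => u (T a) (phi i.+1 a x)) hf).
Qed.

Definition transport (f : subz (cocycle Pr Y i)) : subz (cocycle Q (restr T Y) i) :=
  Sub (restr_nt T (val f) \on phi i) (transport_cocycle f).

Lemma transportB : zmod_morphism transport.
Proof.
by move=> f g; apply: val_inj; apply: nt_ext.
Qed.

Lemma transport_coboundary f :
  f \in coboundary Pr Y i -> transport f \in coboundary Q (restr T Y) i.
Proof.
move=> /asboolP hf; apply/asboolP; move: f hf; rewrite /transport /=.
case: i => [|j] [f /= f0] /=; first by move=> ->; apply: nt_ext.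
case=> g ->; exists (restr_nt T g \on phi j); apply: nt_ext => a x /=.
by have /= -> := congr1 (fun u : nat_trans _ _ => u a x) (cmp_d phi j).
Qed.

(* The map Ext^i_D(X, Y) -> Ext^i_C(T^* X, T^* Y) induced by the exact functor
   T^* = restr T; by [Ext_mapE] it does not depend on representatives. *)
Definition Ext_map (x : Ext Pr Y i) : Ext Q (restr T Y) i :=
  Ext_class (transport (repr x)).

Lemma Ext_mapE f : Ext_map (Ext_class f) = Ext_class (transport f).
Proof.
apply/Ext_classE; rewrite -transportB; apply: transport_coboundary.
by apply/Ext_classE; rewrite /Ext_class reprK.
Qed.

Lemma Ext_mapB : zmod_morphism Ext_map.
Proof.
move=> x y; have [f ->] := Ext_classP x; have [g ->] := Ext_classP y.
by rewrite -Ext_classB !Ext_mapE transportB Ext_classB.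
Qed.

End ExtMap.

Record ideal (C : preadditive) := Ideal {
  idl :> forall a b : C, zmodClosed (hom a b);
  idl_compl : forall a b c (g : hom b c) (f : hom a b),
    f \in idl a b -> g \oc f \in idl a c;
  idl_compr : forall a b c (g : hom b c) (f : hom a b),
    g \in idl b c -> g \oc f \in idl a c
}.

Section QuotientCategory.
Variables (C : preadditive) (I : ideal C).

Definition qhom (a b : C) : zmodType := {ideal_quot (I a b)}.
Definition qpi (a b : C) (f : hom a b) : qhom a b := \pi_({ideal_quot (I a b)}) f.
Definition qcomp (a b c : C) (g : qhom b c) (f : qhom a b) : qhom a c :=
  qpi (repr g \oc repr f).

Lemma qpiE a b (f g : hom a b) : qpi f = qpi g <-> f - g \in I a b.
Proof. by rewrite /qpi Quotient.idealrBE; split=> [/eqP|/eqP]. Qed.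

Lemma qpiP a b (x : qhom a b) : exists f, x = qpi f.
Proof. by exists (repr x); rewrite /qpi reprK. Qed.

Lemma qpiB a b : zmod_morphism (@qpi a b).
Proof. by move=> f g; rewrite /qpi raddfB. Qed.

Lemma qcomp_pi a b c (g : hom b c) (f : hom a b) : qcomp (qpi g) (qpi f) = qpi (g \oc f).
Proof.
have hg : repr (qpi g) - g \in I b c by apply/qpiE; rewrite /qpi reprK.
have hf : repr (qpi f) - f \in I a b by apply/qpiE; rewrite /qpi reprK.
apply/qpiE; set g' := repr _ in hg *; set f' := repr _ in hf *.
have -> : g' \oc f' - g \oc f = (g' - g) \oc f' + g \oc (f' - f).
  by rewrite compBl compBr addrA subrK.
by apply: rpredD; [apply: idl_compr | apply: idl_compl].
Qed.

Program Definition quot_cat : preadditive :=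
  @Preadditive C qhom (fun a => qpi (idm a)) qcomp _ _ _ _ _.
Next Obligation.
move=> a b c d h g f; have [h' ->] := qpiP h; have [g' ->] := qpiP g.
by have [f' ->] := qpiP f; rewrite !qcomp_pi compA.
Qed.
Next Obligation. by move=> a b f; have [f' ->] := qpiP f; rewrite qcomp_pi comp1m. Qed.
Next Obligation. by move=> a b f; have [f' ->] := qpiP f; rewrite qcomp_pi compm1. Qed.
Next Obligation.
move=> a b c f g h; have [h' ->] := qpiP h; have [g' ->] := qpiP g.
by have [f' ->] := qpiP f; rewrite -qpiB !qcomp_pi compBl qpiB.
Qed.
Next Obligation.
move=> a b c f g h; have [h' ->] := qpiP h; have [g' ->] := qpiP g.
by have [f' ->] := qpiP f; rewrite -qpiB !qcomp_pi compBr qpiB.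
Qed.

Program Definition quot_fun : addfun C quot_cat :=
  @AddFun C quot_cat (fun a => a) (fun a b f => qpi f) _ _ _.
Next Obligation. by move=> a b; apply: qpiB. Qed.
Next Obligation. by []. Qed.
Next Obligation. by move=> a b c g f; rewrite /comp /= qcomp_pi. Qed.

(* The comparison of Ext groups is stated for all choices of projective
   resolutions and of chain maps between them, as the induced map is
   independent of these up to the canonical isomorphisms of Ext groups. *)
Definition idempotent_upto (n : enat) : Prop :=
  forall (F F' : functor quot_cat) (i : nat), leqe i n ->
  forall (Pr : projres F) (Q : projres (restr quot_fun F)) (phi : comparison Pr Q),
    bijective (Ext_map phi (Y := F') (i := i)).

(* I(a, -) as a subfunctor of Hom(a, -). *)
Program Definition ideal_functor (a : C) : functor C :=
  @Functor C (fun b => subz (I a b))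
    (fun b c g x => Sub (g \oc val x) (idl_compl g (valP x))) _ _ _ _.
Next Obligation. by move=> a b c g x y; apply: val_inj; rewrite /= compBr. Qed.
Next Obligation. by move=> a b c f g x; apply: val_inj; rewrite /= compBl. Qed.
Next Obligation. by move=> a b x; apply: val_inj; rewrite /= comp1m. Qed.
Next Obligation. by move=> a b c d g f x; apply: val_inj; rewrite /= compA. Qed.

End QuotientCategory.

Section Trace.
Variables (C : preadditive) (P : functor C).

(* The sum of the images of all morphisms from P to N, at the object b. *)
Definition trace (N : functor C) (b : C) : {pred N b} :=
  [pred x | `[< exists (n : nat) (u : 'I_n -> nat_trans P N) (y : 'I_n -> P b),
                  x = \sum_i u i b (y i) >]].
Arguments trace N b _ : clear implicits.

Lemma trace_closed N b : zmod_closed (trace N b).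
Proof.
split=> [|x y]; first by apply/asboolP; exists 0%N, (fun _ => 0), (fun _ => 0); rewrite big_ord0.
move=> /asboolP[m [u [x' ->]]] /asboolP[n [v [y' ->]]]; apply/asboolP.
exists (m + n)%N, (fun i => match split i with inl j => u j | inr j => v j end),
  (fun i => match split i with inl j => x' j | inr j => - y' j end).
rewrite big_split_ord /=; congr (_ + _); last rewrite -sumrN; apply: eq_bigr => i _.
  by rewrite -[lshift _ _]/(unsplit (inl i)) unsplitK.
by rewrite -[rshift _ _]/(unsplit (inr i)) unsplitK raddfN.
Qed.

HB.instance Definition _ N b := GRing.isZmodClosed.Build _ (trace N b) (trace_closed N b).

Definition trace_sub (N : functor C) b : zmodClosed (N b) := trace N b.

Program Definition rep_precomp (a b : C) (f : hom a b) : nat_trans (rep b) (rep a) :=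
  @NatTrans _ (rep b) (rep a) (fun c g => g \oc f) _ _.
Next Obligation. by move=> a b f c; apply: compBl. Qed.
Next Obligation. by move=> a b f c d g x /=; rewrite compA. Qed.

Program Definition trace_ideal : ideal C :=
  @Ideal C (fun a b => trace_sub (rep a) b) _ _.
Next Obligation.
move=> a b c g f /asboolP[n [u [y ->]]]; apply/asboolP.
exists n, u, (fun i => fmap P g (y i)).
rewrite -[LHS]/(fmap (rep a) g _) raddf_sum; apply: eq_bigr => i _.
by rewrite nt_nat.
Qed.
Next Obligation.
move=> a b c g f /asboolP[n [u [y ->]]]; apply/asboolP.
exists n, (fun i => rep_precomp f \on u i), y.
by rewrite -[LHS]/(rep_precomp f c _) raddf_sum.
Qed.

Program Definition power (n : nat) : functor C :=
  @Functor C (fun a => {ffun 'I_n -> P a})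
    (fun a b f x => [ffun i => fmap P f (x i)]) _ _ _ _.
Next Obligation. by move=> n a b f x y; apply/ffunP => i; rewrite !ffunE raddfB. Qed.
Next Obligation. by move=> n a b f g x; apply/ffunP => i; rewrite !ffunE fmap_addl. Qed.
Next Obligation. by move=> n a x; apply/ffunP => i; rewrite ffunE fmap_id. Qed.
Next Obligation. by move=> n a b c g f x; apply/ffunP => i; rewrite !ffunE fmap_comp. Qed.

(* X is a direct summand of a finite direct sum of copies of P. *)
Definition in_add (X : functor C) : Prop :=
  exists (n : nat) (s : nat_trans X (power n)) (r : nat_trans (power n) X),
    r \on s = nt_id X.

(* The class P_k; the resolution is taken in mod(C), hence its terms are
   finitely presented. *)
Definition in_PP (k : enat) (X : functor C) : Prop :=
  fin_pres X /\
  exists Pr : projres X,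
    (forall i, fin_pres (Pr i)) /\ (forall i, leqe i k -> in_add (Pr i)).

End Trace.

Record lincat (R : comPzRingType) := Lincat {
  lob : Type;
  lhom : lob -> lob -> lmodType R;
  lid : forall a, lhom a a;
  lcomp : forall a b c, lhom b c -> lhom a b -> lhom a c;
  lcompA : forall a b c d (h : lhom c d) (g : lhom b c) (f : lhom a b),
    lcomp h (lcomp g f) = lcomp (lcomp h g) f;
  lcomp1m : forall a b (f : lhom a b), lcomp (lid b) f = f;
  lcompm1 : forall a b (f : lhom a b), lcomp f (lid a) = f;
  lcomp_linl : forall a b c (r : R) (g h : lhom b c) (f : lhom a b),
    lcomp (r *: g + h) f = r *: lcomp g f + lcomp h f;
  lcomp_linr : forall a b c (r : R) (g : lhom b c) (f h : lhom a b),
    lcomp g (r *: f + h) = r *: lcomp g f + lcomp g h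
}.
Arguments lhom {R _} a b.
Arguments lid {R _} a.
Arguments lcomp {R _ _ _ _} g f.

Section LincatTheory.
Variables (R : comPzRingType) (C : lincat R) (a b c : lob C).

Lemma lcompBl (f : lhom a b) (g h : lhom b c) : lcomp (g - h) f = lcomp g f - lcomp h f.
Proof. by rewrite addrC -scaleN1r lcomp_linl scaleN1r addrC. Qed.
Lemma lcompBr (g : lhom b c) (f h : lhom a b) : lcomp g (f - h) = lcomp g f - lcomp g h.
Proof. by rewrite addrC -scaleN1r lcomp_linr scaleN1r addrC. Qed.
Lemma lcompZl r (f : lhom a b) (g : lhom b c) : lcomp (r *: g) f = r *: lcomp g f.
Proof.
have := lcomp_linl r g 0 f; rewrite addr0 => ->.
by rewrite -[0](subrr 0) lcompBl subrr addr0.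
Qed.
Lemma lcompZr r (g : lhom b c) (f : lhom a b) : lcomp g (r *: f) = r *: lcomp g f.
Proof.
have := lcomp_linr r g f 0; rewrite addr0 => ->.
by rewrite -[0](subrr 0) lcompBr subrr addr0.
Qed.

End LincatTheory.

Program Definition preadd R (C : lincat R) : preadditive :=
  @Preadditive (lob C) (fun a b => lhom a b) (@lid R C) (@lcomp R C) _ _ _ _ _.
Next Obligation. by move=> R C; apply: lcompA. Qed.
Next Obligation. by move=> R C; apply: lcomp1m. Qed.
Next Obligation. by move=> R C; apply: lcompm1. Qed.
Next Obligation. by move=> R C a b c f g h; apply: lcompBl. Qed.
Next Obligation. by move=> R C a b c g f h; apply: lcompBr. Qed.
Coercion preadd : lincat >-> preadditive.

Program Definition opcat R (C : lincat R) : lincat R :=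
  @Lincat R (lob C) (fun a b => @lhom R C b a) (@lid R C)
    (fun a b c g f => lcomp f g) _ _ _ _ _.
Next Obligation. by move=> R C a b c d h g f; rewrite /= lcompA. Qed.
Next Obligation. by move=> R C a b f; rewrite /= lcompm1. Qed.
Next Obligation. by move=> R C a b f; rewrite /= lcomp1m. Qed.
Next Obligation. by move=> R C a b c r g h f; apply: lcomp_linr. Qed.
Next Obligation. by move=> R C a b c r g f h; apply: lcomp_linl. Qed.

Section Varieties.
Variable C : preadditive.

Definition has_zero : Prop :=
  exists z : C, forall a, (forall f g : hom a z, f = g) /\ (forall f g : hom z a, f = g).

Definition has_biproducts : Prop :=
  forall a b : C, exists (s : C) (i1 : hom a s) (i2 : hom b s)
      (p1 : hom s a) (p2 : hom s b),
    [/\ p1 \oc i1 = idm a, p2 \oc i2 = idm b, p1 \oc i2 = 0, p2 \oc i1 = 0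
      & i1 \oc p1 + i2 \oc p2 = idm s].

Definition additive_cat : Prop := has_zero /\ has_biproducts.

Definition idempotents_split : Prop :=
  forall (a : C) (e : hom a a), e \oc e = e ->
  exists (b : C) (i : hom b a) (p : hom a b), i \oc p = e /\ p \oc i = idm b.

End Varieties.

Definition homfinite_variety R (C : lincat R) : Prop :=
  [/\ additive_cat C, idempotents_split C & forall a b : lob C, fin_gen (lhom a b)].

Section Duality.
Variables (R : comPzRingType) (C : lincat R) (E : lmodType R).

Section ValueModule.
Variables (M : functor C) (a : lob C).

(* M(a) as an R-module, on which r acts as M(r . 1_a). *)
Definition value : Type := M a.

HB.instance Definition _ := GRing.Zmodule.copy value (M a).

Definition value_scale (r : R) (x : value) : value :=
  fmap M (r *: lid a : lhom a a) x.

Lemma value_scaleA r s x : value_scale r (value_scale s x) = value_scale (r * s) x.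
Proof.
rewrite /value_scale -fmap_comp /comp /=; congr (fmap M _ x).
by rewrite lcompZl lcompZr lcomp1m scalerA.
Qed.
Lemma value_scale1 : left_id 1 value_scale.
Proof. by move=> x; rewrite /value_scale scale1r; apply: fmap_id. Qed.
Lemma value_scaleDr : right_distributive value_scale +%R.
Proof. by move=> r x y; apply: (raddfD (fmap M _)). Qed.
Lemma value_scaleDl x : {morph value_scale^~ x : r s / r + s}.
Proof.
move=> r s; rewrite /value_scale scalerDl.
have e (f g : @hom C a a) : fmap M (f + g) x = fmap M f x + fmap M g x.
  have h : fmap M (0 : @hom C a a) x = 0 by rewrite -[0 in LHS](subrr 0) fmap_addl subrr.
  have : fmap M (f - (0 - g)) x = fmap M f x - (fmap M (0 : @hom C a a) x - fmap M g x).
    by rewrite !fmap_addl.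
  by rewrite h !sub0r !opprK.
exact: e.
Qed.

HB.instance Definition _ := GRing.Zmodule_isLmodule.Build R value
  value_scaleA value_scale1 value_scaleDr value_scaleDl.

End ValueModule.

Definition value_map (M : functor C) (a b : lob C) (f : @hom C a b) :
  value M a -> value M b := fmap M f.

Lemma value_map_linear M a b f : linear (@value_map M a b f).
Proof.
move=> r x y; rewrite /value_map raddfD; congr (_ + _).
rewrite -[LHS]/(fmap M f (fmap M (r *: lid a : lhom a a) x)).
rewrite -[RHS]/(fmap M (r *: lid b : lhom b b) (fmap M f x)) -!fmap_comp.
congr (fmap M _ x); rewrite /comp /=.
by rewrite lcompZl lcompZr lcomp1m lcompm1.
Qed.

HB.instance Definition _ M a b f :=
  GRing.isLinear.Build R (value M a) (value M b) *:%R (@value_map M a b f)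
    (@value_map_linear M a b f).

Definition value_nt (M N : functor C) (u : nat_trans M N) (a : lob C) :
  value M a -> value N a := u a.

Lemma value_nt_linear M N u a : linear (@value_nt M N u a).
Proof.
move=> r x y; rewrite /value_nt raddfD; congr (_ + _).
by rewrite -[LHS]/(u a (fmap M (r *: lid a : lhom a a) x)) nt_nat.
Qed.

HB.instance Definition _ M N u a :=
  GRing.isLinear.Build R (value M a) (value N a) *:%R (@value_nt M N u a)
    (@value_nt_linear M N u a).

(* D(M)(a) = Hom_R(M(a), E). *)
Program Definition dual (M : functor C) : functor (opcat C) :=
  @Functor (opcat C) (fun a => lin (value M a) E)
    (fun a b f h => (h : {linear _ -> _}) \o value_map f : {linear _ -> _}) _ _ _ _.
Next Obligation. by move=> M a b f h h'; apply: lin_ext. Qed.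
Next Obligation.
move=> M a b f g h; apply: lin_ext => x /=.
by rewrite /value_map fmap_addl raddfB.
Qed.
Next Obligation. by move=> M a h; apply: lin_ext => x /=; rewrite /value_map fmap_id. Qed.
Next Obligation.
move=> M a b c g f h; apply: lin_ext => x /=.
by rewrite /value_map -fmap_comp.
Qed.

Program Definition dual_nt (M N : functor C) (u : nat_trans M N) :
    nat_trans (dual N) (dual M) :=
  @NatTrans _ (dual N) (dual M)
    (fun a h => (h : {linear _ -> _}) \o value_nt u (a := a) : {linear _ -> _}) _ _.
Next Obligation. by move=> M N u a h h'; apply: lin_ext. Qed.
Next Obligation.
move=> M N u a b f h; apply: lin_ext => x /=.
by rewrite /value_map /value_nt nt_nat.
Qed.

(* D restricts to a contravariant equivalence mod(C) -> mod(C^op). *)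
Definition dualizing : Prop :=
  [/\ forall M : functor C, fin_pres M -> fin_pres (dual M),
      forall M N : functor C, fin_pres M -> fin_pres N ->
        bijective (@dual_nt M N)
    & forall N : functor (opcat C), fin_pres N ->
        exists M : functor C, fin_pres M /\ nt_iso (dual M) N].

End Duality.

(* Main.v *)
From HB Require Import structures.
From mathcomp Require Import all_boot all_algebra.
From mathcomp Require Import boolp.
Require Import Defs.

Set Implicit Arguments.
Unset Strict Implicit.
Unset Printing Implicit Defensive.

Import GRing.Theory.
Local Open Scope ring_scope.
Local Open Scope quotient_scope.
#[local] Obligation Tactic := idtac.

(** Write P for Hom(c, -), I for its trace ideal and Tr for the trace of P.  By
    Yoneda, I(a, b) consists of the finite sums of maps a -> b that factor
    through c, and Mod(C/I) is the category of the functors Y on C with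
    Y(c) = 0.  There are no nonzero maps from a summand of a power of P to such
    a Y, which is what links resolutions by add(P) to Ext groups with values in
    Mod(C/I).

    Sufficiency.  Let Q be a projective resolution over C of a functor F with
    F(c) = 0.  Maps from Q to a functor killed at c are maps from Q / Tr Q,
    which is a complex of projectives over C/I, and the comparison of the Ext
    groups is induced by a chain map from Q / Tr Q to a projective resolution of
    F over C/I.  Its cone is a complex of projectives; where the cone is exact
    it is contractible, so the comparison is bijective up to degree k + 1 as
    soon as Q / Tr Q is exact in the degrees 1, ..., k + 1
    ([trace_exact_of_PP]).  That is shown by dimension shifting over all F at
    once.  The functor F is a quotient of L / Tr L with L a coproduct of
    representables.  A resolution of L / Tr L is L itself followed by the
    coproduct of the given resolutions of the I(a, -): its terms in the degrees
    1, ..., k + 1 coincide with their traces, so nothing is left to be exact.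
    The kernel of L / Tr L -> F again vanishes at c, and the cone of a lift of
    its inclusion resolves F.

    Necessity.  A dualizing variety has weak cokernels: they are the kernels in
    mod(C), read off from cokernels over the opposite category by the duality
    ([weak_cokernel_exists]).  Iterating them from a map a -> c^n that generates
    Hom(a, c) gives a resolution of Hom(a, -) / I(a, -) by representables,
    and each new object may be chosen in add(c) if the kernel that it covers is
    generated by P.  The latter is forced by the vanishing of Ext over C from
    Hom(a, -) / I(a, -), which idempotency gives because this functor is
    projective over C/I: for the kernel K of the differential on a term in
    add(P), the composite of the next term with K -> K / Tr K is a cocycle, so
    it factors through the term in add(P) and is zero; as it is onto, K is equal
    to its trace ([rseq_trace_generated]). *)

Arguments pr_proj {C X} p i.
Arguments pr_epi {C X} p.
Arguments pr_exact0 {C X} p.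
Arguments pr_exact {C X} p i.

(** * Functors on a preadditive category *)

Lemma nt_eqP C (F G : functor C) (u v : nat_trans F G) :
  u = v -> forall a x, u a x = v a x.
Proof. by move=> ->. Qed.
Arguments nt_eqP {C F G u v} _ a x.

Lemma fmap0l C (F : functor C) a b x : fmap F (0 : hom a b) x = 0.
Proof. by rewrite -[0 in LHS](subrr 0) fmap_addl subrr. Qed.

Section Composition.
Variable C : preadditive.
Implicit Types a b : C.

HB.instance Definition _ a b d (g : hom b d) :=
  GRing.isZmodMorphism.Build (hom a b) (hom a d) (comp g) (compBr g).

Lemma comp0l a b d (f : hom a b) : (0 : hom b d) \oc f = 0.
Proof. by rewrite -[0 in LHS](subrr 0) compBl subrr. Qed.

Lemma comp0r a b d (g : hom b d) : g \oc (0 : hom a b) = 0.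
Proof. exact: raddf0. Qed.

Lemma compDl a b d (f : hom a b) (g h : hom b d) :
  (g + h) \oc f = g \oc f + h \oc f.
Proof. exact: (raddfD (rep_precomp f d)). Qed.

Lemma compDr a b d (g : hom b d) (f h : hom a b) :
  g \oc (f + h) = g \oc f + g \oc h.
Proof. exact: raddfD. Qed.

Lemma comp_suml a b d n (f : hom a b) (g : 'I_n -> hom b d) :
  (\sum_i g i) \oc f = \sum_i g i \oc f.
Proof. exact: (raddf_sum (rep_precomp f d)). Qed.

Lemma comp_sumr a b d n (g : hom b d) (f : 'I_n -> hom a b) :
  g \oc (\sum_i f i) = \sum_i g \oc f i.
Proof. exact: raddf_sum. Qed.

End Composition.

Section Constructions.
Variable C : preadditive.
Implicit Types (a b : C) (F G H M N X : functor C).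

Program Definition yoneda F a (x : F a) : nat_trans (rep a) F :=
  @NatTrans _ (rep a) F (fun b f => fmap F f x) _ _.
Next Obligation. by move=> F a x b f g; apply: fmap_addl. Qed.
Next Obligation. by move=> F a x b d f g; rewrite -fmap_comp. Qed.

Lemma yonedaE F a (u : nat_trans (rep a) F) b f : u b f = fmap F f (u a (idm a)).
Proof. by rewrite -nt_nat /= compm1. Qed.

Lemma rep_projective a : projective (rep a).
Proof.
move=> M N e epi_e f; have [x ex] := epi_e a (f a (idm a)).
exists (yoneda x); apply: nt_ext => b g /=.
by rewrite nt_nat ex -yonedaE.
Qed.

Section Kernel.
Variables (F G : functor C) (u : nat_trans F G).

Definition ker_pred a : {pred F a} := [pred x | u a x == 0].

Lemma ker_closed a : zmod_closed (@ker_pred a).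
Proof.
split=> [|x y]; rewrite !inE; first by rewrite raddf0.
by move=> /eqP ux /eqP uy; rewrite raddfB /= ux uy subr0.
Qed.

HB.instance Definition _ a := GRing.isZmodClosed.Build _ (@ker_pred a) (ker_closed a).

Lemma ker_fmap a b (f : hom a b) x : x \in @ker_pred a -> fmap F f x \in @ker_pred b.
Proof. by rewrite !inE => /eqP ux; rewrite nt_nat ux raddf0. Qed.

Program Definition kerf : functor C :=
  @Functor C (fun a => subz (@ker_pred a))
    (fun a b f x => Sub (fmap F f (val x)) (ker_fmap f (valP x))) _ _ _ _.
Next Obligation. by move=> a b f x y; apply: val_inj; rewrite /= raddfB. Qed.
Next Obligation. by move=> a b f g x; apply: val_inj; rewrite /= fmap_addl. Qed.
Next Obligation. by move=> a x; apply: val_inj; rewrite /= fmap_id. Qed.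
Next Obligation. by move=> a b d g f x; apply: val_inj; rewrite /= fmap_comp. Qed.

Program Definition ker_incl : nat_trans kerf F :=
  @NatTrans _ kerf F (fun a x => val x) _ _.
Next Obligation. by []. Qed.
Next Obligation. by []. Qed.

Lemma ker_inclP a (x : kerf a) : u a (ker_incl a x) = 0.
Proof. by case: x => x /= /eqP. Qed.

Lemma ker_incl_inj a (x y : kerf a) : ker_incl a x = ker_incl a y -> x = y.
Proof. exact: val_inj. Qed.

Lemma mem_ker a x : u a x = 0 -> x \in @ker_pred a.
Proof. by rewrite inE => ->. Qed.

Program Definition ker_lift X (v : nat_trans X F) (uv : forall a x, u a (v a x) = 0) :
    nat_trans X kerf :=
  @NatTrans _ X kerf (fun a x => Sub (v a x) (mem_ker (uv a x))) _ _.
Next Obligation. by move=> X v uv a x y; apply: val_inj; rewrite /= raddfB. Qed.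
Next Obligation. by move=> X v uv a b f x; apply: val_inj; rewrite /= nt_nat. Qed.

Lemma ker_mem a x : u a x = 0 -> exists y : kerf a, ker_incl a y = x.
Proof.
by move=> /mem_ker ux; exists (Sub x ux).
Qed.

End Kernel.

Lemma projective_lift X F G H (u : nat_trans F G) (v : nat_trans G H) (w : nat_trans X G) :
    projective X -> exact_at u v -> (forall a x, v a (w a x) = 0) ->
  exists g : nat_trans X F, forall a x, u a (g a x) = w a x.
Proof.
move=> projX uv vw.
have vu a x : v a (u a x) = 0 by apply/uv; exists x.
have epi : nt_epi (ker_lift vu).
  move=> a y; have /uv[x ux] := ker_inclP y.
  by exists x; apply: ker_incl_inj; rewrite /= ux.
have [g eg] := projX _ _ _ epi (ker_lift vw); exists g => a x.
by have /(congr1 (ker_incl v a)) := nt_eqP eg a x.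
Qed.

Program Definition zerof : functor C :=
  @Functor C (fun _ => 'rV[int]_0) (fun _ _ _ x => x) _ _ _ _.
Next Obligation. by []. Qed.
Next Obligation. by move=> a b f g x; rewrite subrr; apply: thinmx0. Qed.
Next Obligation. by []. Qed.
Next Obligation. by []. Qed.

Lemma zerof_projective : projective zerof.
Proof.
move=> M N e _ f; exists 0; apply: nt_ext => a x.
by rewrite (thinmx0 x) !raddf0.
Qed.

Section DirectSum.
Variables F G : functor C.

Program Definition sumf : functor C :=
  @Functor C (fun a => (F a * G a)%type)
    (fun a b f x => (fmap F f x.1, fmap G f x.2)) _ _ _ _.
Next Obligation. by move=> a b f [x1 x2] [y1 y2]; rewrite /= !raddfB. Qed.
Next Obligation. by move=> a b f g [x1 x2]; rewrite /= !fmap_addl. Qed.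
Next Obligation. by move=> a [x1 x2]; rewrite /= !fmap_id. Qed.
Next Obligation. by move=> a b d g f [x1 x2]; rewrite /= !fmap_comp. Qed.

Program Definition inl_nt : nat_trans F sumf :=
  @NatTrans _ F sumf (fun a x => (x, 0)) _ _.
Next Obligation. by move=> a x y; congr (_, _); rewrite subr0. Qed.
Next Obligation. by move=> a b f x; rewrite /= raddf0. Qed.

Program Definition inr_nt : nat_trans G sumf :=
  @NatTrans _ G sumf (fun a x => (0, x)) _ _.
Next Obligation. by move=> a x y; congr (_, _); rewrite subr0. Qed.
Next Obligation. by move=> a b f x; rewrite /= raddf0. Qed.

Program Definition fst_nt : nat_trans sumf F :=
  @NatTrans _ sumf F (fun a x => x.1) _ _.
Next Obligation. by []. Qed.
Next Obligation. by []. Qed.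

Program Definition snd_nt : nat_trans sumf G :=
  @NatTrans _ sumf G (fun a x => x.2) _ _.
Next Obligation. by []. Qed.
Next Obligation. by []. Qed.

Lemma sumf_projective : projective F -> projective G -> projective sumf.
Proof.
move=> pF pG M N e epi_e f.
have [g1 e1] := pF _ _ _ epi_e (f \on inl_nt).
have [g2 e2] := pG _ _ _ epi_e (f \on inr_nt).
exists (g1 \on fst_nt + g2 \on snd_nt); apply: nt_ext => a [x y] /=.
rewrite raddfD /=; have /= -> := nt_eqP e1 a x; have /= -> := nt_eqP e2 a y.
by rewrite -raddfD /=; congr (f a (_, _)); rewrite ?addr0 ?add0r.
Qed.

End DirectSum.

End Constructions.

(** * Reduction modulo the trace *)

Section Trace.
Variables (C : preadditive) (P : functor C).
Implicit Types (a b : C) (M N X : functor C).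

Lemma trace_nt M N (u : nat_trans M N) b x :
  x \in trace_sub P M b -> u b x \in trace_sub P N b.
Proof.
move=> /asboolP[n [v [y ->]]]; apply/asboolP.
by exists n, (fun i => u \on v i), y; rewrite raddf_sum.
Qed.

Lemma trace_fmap N a b (f : hom a b) x :
  x \in trace_sub P N a -> fmap N f x \in trace_sub P N b.
Proof.
move=> /asboolP[n [v [y ->]]]; apply/asboolP.
exists n, v, (fun i => fmap P f (y i)).
by rewrite raddf_sum; apply: eq_bigr => i _; rewrite nt_nat.
Qed.

Lemma trace_ideal_fmap N a b (f : hom a b) x :
  f \in trace_ideal P a b -> fmap N f x \in trace_sub P N b.
Proof. by move=> /(trace_nt (yoneda x)). Qed.

Lemma trace_sumf M N b (x : sumf M N b) :
  x.1 \in trace_sub P M b -> x.2 \in trace_sub P N b ->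
  x \in trace_sub P (sumf M N) b.
Proof.
case: x => x y /= /(trace_nt (inl_nt M N)) /= hx /(trace_nt (inr_nt M N)) /= hy.
by rewrite -[x]addr0 -[y]add0r; apply: rpredD hx hy.
Qed.

Program Definition power_inj n (i : 'I_n) : nat_trans P (power P n) :=
  @NatTrans _ P (power P n) (fun a x => [ffun j => if j == i then x else 0]) _ _.
Next Obligation.
by move=> n i a x y; apply/ffunP => j; rewrite !ffunE; case: eqP; rewrite ?subr0.
Qed.
Next Obligation.
by move=> n i a b f x; apply/ffunP => j; rewrite !ffunE; case: eqP; rewrite ?raddf0.
Qed.

Lemma in_add_trace N : in_add P N -> forall b (x : N b), x \in trace_sub P N b.
Proof.
move=> [n [s [r rs]]] b x; rewrite -[x](nt_eqP rs b x) /=.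
apply/trace_nt/asboolP; move: (s b x) => {x}y.
exists n, (@power_inj n), (fun i => y i); apply/ffunP => j.
rewrite sum_ffunE (bigD1 j) //= ffunE eqxx big1 ?addr0 // => i ij.
by rewrite ffunE eq_sym (negPf ij).
Qed.

Section Reduction.
Variable X : functor C.

Definition red_ob b : zmodType := {ideal_quot (trace_sub P X b)}.
Definition red_pi b (x : X b) : red_ob b := \pi_({ideal_quot (trace_sub P X b)}) x.

Lemma red_piE b (x y : X b) : red_pi x = red_pi y <-> x - y \in trace_sub P X b.
Proof. by rewrite /red_pi Quotient.idealrBE; split=> [/eqP|/eqP]. Qed.

Lemma red_piP b (x : red_ob b) : exists y, x = red_pi y.
Proof. by exists (repr x); rewrite /red_pi reprK. Qed.

Lemma red_piB b : zmod_morphism (@red_pi b).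
Proof. by move=> x y; rewrite /red_pi raddfB. Qed.

HB.instance Definition _ b :=
  GRing.isZmodMorphism.Build (X b) (red_ob b) (@red_pi b) (@red_piB b).

Lemma red_pi0 b (x : X b) : red_pi x = 0 <-> x \in trace_sub P X b.
Proof. by rewrite -(raddf0 (@red_pi b)) red_piE subr0. Qed.

Definition red_map a b (g : qhom (trace_ideal P) a b) (x : red_ob a) : red_ob b :=
  red_pi (fmap X (repr g) (repr x)).

Lemma red_map_pi a b (g : hom a b) (x : X a) :
  red_map (qpi (trace_ideal P) g) (red_pi x) = red_pi (fmap X g x).
Proof.
have hg : repr (qpi (trace_ideal P) g) - g \in trace_ideal P a b.
  by apply/qpiE; rewrite /qpi reprK.
have hx : repr (red_pi x) - x \in trace_sub P X a.
  by apply/red_piE; rewrite /red_pi reprK.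
apply/red_piE; move: (repr _) hg (repr _) hx => g' hg x' hx.
rewrite -[X in X - _](subrK (fmap X g x')) -fmap_addl -addrA -raddfB.
by apply: rpredD; [apply: trace_ideal_fmap | apply: trace_fmap].
Qed.

(** The left adjoint of the restriction along C -> C/I: the ideal acts as zero
    on X / Tr X because the map Hom(a, -) -> X of an element of X(a) preserves
    traces. *)
Program Definition reduce : functor (quot_cat (trace_ideal P)) :=
  @Functor (quot_cat (trace_ideal P)) red_ob red_map _ _ _ _.
Next Obligation.
move=> a b f x y; have [g ->] := qpiP f; have [x' ->] := red_piP x.
by have [y' ->] := red_piP y; rewrite -raddfB !red_map_pi !raddfB.
Qed.
Next Obligation.
move=> a b f g x; have [f' ->] := qpiP f; have [g' ->] := qpiP g.
have [x' ->] := red_piP x.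
by rewrite -qpiB !red_map_pi fmap_addl raddfB.
Qed.
Next Obligation.
by move=> a x; have [x' ->] := red_piP x; rewrite /= red_map_pi fmap_id.
Qed.
Next Obligation.
move=> a b d g f x; have [f' ->] := qpiP f; have [g' ->] := qpiP g.
have [x' ->] := red_piP x.
by rewrite /comp /= qcomp_pi !red_map_pi fmap_comp.
Qed.

Program Definition red_unit : nat_trans X (restr (quot_fun (trace_ideal P)) reduce) :=
  @NatTrans _ X (restr (quot_fun (trace_ideal P)) reduce) red_pi _ _.
Next Obligation. exact: red_piB. Qed.
Next Obligation. by move=> a b f x; rewrite /= red_map_pi. Qed.

Lemma red_unit_epi : nt_epi red_unit.
Proof. by move=> b y; have [x ->] := red_piP y; exists x. Qed.

Variables (M : functor C) (u : nat_trans X M).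
Hypothesis trM : forall b (x : M b), x \in trace_sub P M b -> x = 0.

Definition red_out_fun b (x : red_ob b) : M b := u b (repr x).

Lemma red_out_pi b (x : X b) : red_out_fun (red_pi x) = u b x.
Proof.
have hx : repr (red_pi x) - x \in trace_sub P X b.
  by apply/red_piE; rewrite /red_pi reprK.
by apply: subr0_eq; have /trM := trace_nt u hx; rewrite raddfB.
Qed.

(** The counit side of the adjunction, for a target M without trace. *)
Program Definition red_out :
    nat_trans (restr (quot_fun (trace_ideal P)) reduce) M :=
  @NatTrans _ (restr (quot_fun (trace_ideal P)) reduce) M red_out_fun _ _.
Next Obligation.
move=> b x y; have [x' ->] := red_piP x; have [y' ->] := red_piP y.
by rewrite -raddfB !red_out_pi raddfB.
Qed.
Next Obligation.
move=> a b f x; have [x' ->] := red_piP x.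
by rewrite /= red_map_pi !red_out_pi nt_nat.
Qed.

End Reduction.

End Trace.

(** Naturality over the quotient category reduces to naturality over C, since
    every map of the quotient comes from C. *)
Program Definition unrestr (C : preadditive) (I : ideal C) (F G : functor (quot_cat I))
    (u : nat_trans (restr (quot_fun I) F) (restr (quot_fun I) G)) : nat_trans F G :=
  @NatTrans _ F G (fun a x => u a x) _ _.
Next Obligation. by move=> C I F G u a; exact: (@nt_add _ _ _ u a). Qed.
Next Obligation. by move=> C I F G u a b f x; have [g ->] := qpiP f; apply: (nt_nat u). Qed.

Section RepTrace.
Variables (C : preadditive) (c : C).
Implicit Types (a b : C) (M N X : functor C).

Lemma rep_traceP N b x : x \in trace_sub (rep c) N b <->
  exists n (y : 'I_n -> hom c b) (z : 'I_n -> N c), x = \sum_i fmap N (y i) (z i).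
Proof.
split=> [/asboolP[n [u [y ->]]] | [n [y [z ->]]]]; last first.
  by apply/asboolP; exists n, (fun i => yoneda (z i)), y.
exists n, y, (fun i => u i c (idm c)).
by apply: eq_bigr => i _; rewrite -yonedaE.
Qed.

Lemma rep_trace0 N : (forall x : N c, x = 0) ->
  forall b x, x \in trace_sub (rep c) N b -> x = 0.
Proof.
move=> N0 b x /rep_traceP[n [y [z ->]]].
by rewrite big1 // => i _; rewrite [z i]N0 raddf0.
Qed.

Lemma restr_rep_trace (F : functor (quot_cat (trace_ideal (rep c)))) (x : F c) : x = 0.
Proof.
rewrite -[x](@fmap_id _ F c) /idm /=.
suff -> : qpi (trace_ideal (rep c)) (idm c) = 0 by apply: fmap0l.
rewrite -[0](raddf0 (\pi_({ideal_quot (trace_ideal (rep c) c c)}))).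
apply/qpiE; rewrite subr0; apply/rep_traceP.
by exists 1%N, (fun _ => idm c), (fun _ => idm c); rewrite big_ord1 /= comp1m.
Qed.

Lemma restr_trace0 (F : functor (quot_cat (trace_ideal (rep c)))) b x :
  x \in trace_sub (rep c) (restr (quot_fun (trace_ideal (rep c))) F) b -> x = 0.
Proof. by apply: rep_trace0; apply: restr_rep_trace. Qed.

Definition red_lift X (F : functor (quot_cat (trace_ideal (rep c))))
    (u : nat_trans X (restr (quot_fun (trace_ideal (rep c))) F)) :
    nat_trans (reduce (rep c) X) F :=
  unrestr (red_out u (@restr_trace0 F)).

Lemma red_liftE X F (u : nat_trans X (restr (quot_fun (trace_ideal (rep c))) F)) b x :
  red_lift u b (red_pi (rep c) x) = u b x.
Proof. exact: (red_out_pi u (@restr_trace0 F)). Qed.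

(** A left adjoint of an exact functor preserves projectives. *)
Lemma reduce_projective X : projective X -> projective (reduce (rep c) X).
Proof.
move=> pX M N e epi_e f.
have [|g eg] := pX _ _ (restr_nt (quot_fun _) e) _
  (restr_nt (quot_fun _) f \on red_unit (rep c) X).
  by move=> a y; apply: epi_e.
exists (red_lift g); apply: nt_ext => a x; have [y ->] := red_piP x.
rewrite -[LHS]/(e a (red_lift g a (red_pi _ y))) red_liftE.
exact: nt_eqP eg a y.
Qed.

End RepTrace.
Arguments red_lift : simpl never.

(** * Complexes of projectives, cones and comparison maps *)

Section Complexes.
Variable C : preadditive.
Implicit Types (a b : C) (M N X Y : functor C).

Record complex := Complex {
  cob :> nat -> functor C;
  cd : forall n, nat_trans (cob n.+1) (cob n);
  cdd : forall n a x, cd n a (cd n.+1 a x) = 0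
}.

(** Complexes end in degree 0, so that exactness there is surjectivity. *)
Definition exact_deg (A : complex) (n : nat) : Prop :=
  if n is m.+1 then exact_at (cd A m.+1) (cd A m) else nt_epi (cd A 0).

Definition res_complex X (Q : projres X) : complex.
Proof.
apply: (@Complex (pr Q) (prd Q)) => n a x.
by apply/(pr_exact Q n); exists x.
Defined.

Definition is_cobound (A : complex) n Y : nat_trans (A n) Y -> Prop :=
  if n is m.+1 then
    fun f => exists g : nat_trans (A m) Y, forall a x, f a x = g a (cd A m a x)
  else fun f => forall a x, f a x = 0.

Section Contraction.
Variables (A : complex) (N : nat).
Hypothesis A_proj : forall n, (n <= N)%N -> projective (A n).
Hypothesis A_exact : forall n, (n <= N)%N -> exact_deg A n.

(** The contraction is built one degree at a time, and only the relation
    d e d = d is carried along: it says that 1 - e d lands in the cycles, which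
    is all that the next lift needs, and it spares a choice of the whole
    sequence of maps. *)
Lemma contraction_step n (e : nat_trans (A n) (A n.+1)) : (n < N)%N ->
    (forall a x, cd A n a (e a (cd A n a x)) = cd A n a x) ->
  exists e' : nat_trans (A n.+1) (A n.+2),
    forall a x, x = cd A n.+1 a (e' a x) + e a (cd A n a x).
Proof.
move=> ltnN ded.
have [||e' ee'] := projective_lift (w := nt_id _ - e \on cd A n) _ (A_exact ltnN).
- exact: A_proj.
- by move=> a x; rewrite raddfB /= ded subrr.
by exists e' => a x; rewrite ee' /= subrK.
Qed.

Lemma contraction n : (n <= N)%N -> exists e : nat_trans (A n) (A n.+1),
  forall a x, cd A n a (e a (cd A n a x)) = cd A n a x.
Proof.
elim: n => [|n IHn] leN.
  have [e de] := A_proj leN (A_exact leN) (nt_id _).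
  by exists e => a x; have /= -> := nt_eqP de a (cd A 0 a x).
have [e ded] := IHn (ltnW leN); have [e' ee'] := contraction_step leN ded.
exists e' => a x; have := ee' a (cd A n.+1 a x).
by rewrite cdd raddf0 addr0 => <-.
Qed.

Lemma homotopy n : (n < N)%N ->
  exists (e : nat_trans (A n) (A n.+1)) (e' : nat_trans (A n.+1) (A n.+2)),
    forall a x, x = cd A n.+1 a (e' a x) + e a (cd A n a x).
Proof.
move=> ltnN; have [e ded] := contraction (ltnW ltnN).
by have [e' ee'] := contraction_step ltnN ded; exists e, e'.
Qed.

Lemma cocycle_cobound n Y (f : nat_trans (A n) Y) : (n <= N)%N ->
  (forall a x, f a (cd A n a x) = 0) -> is_cobound f.
Proof.
case: n f => [|n] f ltnN fd.
  by move=> a x; have [y <-] := A_exact ltnN a x; apply: fd.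
have [e [e' ee']] := homotopy ltnN.
by exists (f \on e) => a x; rewrite [in LHS](ee' a x) raddfD /= fd add0r.
Qed.

End Contraction.

Section Cone.
Variables (A B : complex) (f : forall n, nat_trans (A n) (B n)).
Hypothesis f_d : forall n a x, f n a (cd A n a x) = cd B n a (f n.+1 a x).

Definition cone_ob n : functor C :=
  if n is m.+1 then sumf (A m) (B m.+1) else B 0%N.

Program Definition cone_d0 : nat_trans (cone_ob 1) (cone_ob 0) :=
  @NatTrans _ (cone_ob 1) (cone_ob 0) (fun a x => f 0 a x.1 + cd B 0 a x.2) _ _.
Next Obligation. by move=> a x y; rewrite /= !raddfB opprD addrACA. Qed.
Next Obligation. by move=> a b g x; rewrite /= !nt_nat raddfD. Qed.

Program Definition cone_dS n : nat_trans (cone_ob n.+2) (cone_ob n.+1) :=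
  @NatTrans _ (cone_ob n.+2) (cone_ob n.+1)
    (fun a x => (- cd A n a x.1, f n.+1 a x.1 + cd B n.+1 a x.2)) _ _.
Next Obligation.
move=> n a x y; rewrite /= !raddfB addrACA; congr (_, _); by rewrite -opprD.
Qed.
Next Obligation. by move=> n a b g x; rewrite /= !nt_nat raddfN raddfD. Qed.

Definition cone_d n : nat_trans (cone_ob n.+1) (cone_ob n) :=
  if n is m.+1 then cone_dS m else cone_d0.

Lemma cone_dd n a x : cone_d n a (cone_d n.+1 a x) = 0.
Proof.
case: n x => [|n] [x y] /=.
  by rewrite raddfN raddfD /= f_d cdd addr0 addNr.
by rewrite !raddfN raddfD /= f_d !cdd addr0 addNr !oppr0.
Qed.

Definition cone : complex := Complex cone_dd.

Definition cone_inr n : nat_trans (B n) (cone n) :=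
  if n is m.+1 then inr_nt (A m) (B m.+1) else nt_id (B 0%N).

Lemma cone_inr_d n a y : cd cone n a (cone_inr n.+1 a y) = cone_inr n a (cd B n a y).
Proof. by case: n y => [|n] y; rewrite /= !raddf0 add0r ?oppr0. Qed.

Lemma cone_projective n : (forall m, (m < n)%N -> projective (A m)) ->
  (forall m, (m <= n)%N -> projective (B m)) -> projective (cone n).
Proof.
case: n => [|n] pA pB; first exact: pB.
by apply: sumf_projective; [apply: pA | apply: pB].
Qed.

(** The exactness argument of the cone once the first component of a cycle is
    known to be a boundary; the hypotheses under which this is known differ
    between degree 1 and the higher degrees. *)
Lemma cone_cycle n a x y x' : exact_deg B n.+1 ->
    x = cd A n a x' -> f n a x + cd B n a y = 0 ->
  exists z, cone_dS n a z = (x, y).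
Proof.
move=> exB -> fxy.
have /exB[y' dy'] : cd B n a (y + f n.+1 a x') = 0.
  by rewrite raddfD /= -f_d addrC.
by exists (- x', y'); rewrite /= !raddfN /= opprK dy' addrC addrK.
Qed.

Lemma cone_exactS n : exact_deg A n.+1 -> exact_deg B n.+2 -> exact_deg cone n.+2.
Proof.
move=> exA exB a [x y]; split; last by case=> z <-; apply: cone_dd.
move=> /= [/eqP]; rewrite oppr_eq0 => /eqP /exA[x' dx'] fxy.
exact: (cone_cycle exB (esym dx')).
Qed.

Section HomCone.
Variables (N : nat) (Y : functor C).
Hypothesis cone_proj : forall n, (n <= N)%N -> projective (cone n).
Hypothesis cone_exact : forall n, (n <= N)%N -> exact_deg cone n.

(** Cochains on the cone are pairs of cochains on A and on B.  A cocycle v on B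
    whose pullback is the coboundary of g is the cocycle (g, v) of the cone. *)
Lemma cone_hom_inj n (v : nat_trans (B n) Y) : (n <= N)%N ->
  (forall a y, v a (cd B n a y) = 0) -> is_cobound (v \on f n) -> is_cobound v.
Proof.
case: n v => [|n] v lenN vd vf.
  move=> a y; have [[x z] <-] := cone_exact lenN a y.
  by rewrite /= raddfD /= vd addr0; apply: vf.
have [g vf_gd] := vf.
pose h : nat_trans (cone n.+1) Y :=
  g \on fst_nt (A n) (B n.+1) + v \on snd_nt (A n) (B n.+1).
have hd a x : h a (cd cone n.+1 a x) = 0.
  case: x => x y; rewrite /= raddfN raddfD /= vd addr0.
  by have /= -> := vf_gd a x; apply: addNr.
have [w hw] := cocycle_cobound cone_proj cone_exact lenN hd.
exists (w \on cone_inr n) => a y; rewrite /= -cone_inr_d -hw /=.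
by rewrite raddf0 add0r.
Qed.

(** A cocycle g on A is the cocycle (g, 0) of the cone in one degree higher;
    its primitive has the sought cocycle on B as its second component. *)
Lemma cone_hom_surj n (g : nat_trans (A n) Y) : (n < N)%N ->
    (forall a x, g a (cd A n a x) = 0) ->
  exists v : nat_trans (B n) Y,
    (forall a y, v a (cd B n a y) = 0) /\ is_cobound (g - v \on f n).
Proof.
move=> ltnN gd.
pose h : nat_trans (cone n.+1) Y := g \on fst_nt (A n) (B n.+1).
have hd a x : h a (cd cone n.+1 a x) = 0 by rewrite /= raddfN /= gd oppr0.
have [w hw] := cocycle_cobound cone_proj cone_exact ltnN hd.
exists (w \on cone_inr n); split=> [a y|].
  by rewrite /= -cone_inr_d -hw /= raddf0.
case: n g ltnN gd @h hd w hw => [|n] g ltnN gd h hd w hw.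
  by move=> a x; have /= -> := hw a (x, 0); rewrite raddf0 addr0 subrr.
exists (- (w \on inl_nt (A n) (B n.+1))) => a x.
have /= -> := hw a (x, 0); rewrite -raddfB -[RHS](raddfN (w a)) raddf0 addr0.
by congr (w a (_, _)); rewrite ?subr0 // subrr oppr0.
Qed.

End HomCone.

Variables (X X' : functor C) (i : nat_trans X X').
Variables (eA : nat_trans (A 0%N) X) (eB : nat_trans (B 0%N) X').
Hypothesis f_aug : forall a x, eB a (f 0 a x) = i a (eA a x).
Hypothesis i_inj : forall a x, i a x = 0 -> x = 0.

(** The first component of a cycle in degree 1 is sent by the augmentation to an
    element that i kills, so it is a boundary because i is a monomorphism. *)
Lemma cone_exact1 : exact_at (cd A 0) eA -> (forall a x, eB a (cd B 0 a x) = 0) ->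
  exact_deg B 1 -> exact_deg cone 1.
Proof.
move=> exA eBd exB a [x y]; split; last by case=> z <-; apply: cone_dd.
move=> /= fxy; have /i_inj /exA[x' dx'] : i a (eA a x) = 0.
  by have := congr1 (eB a) fxy; rewrite raddfD /= eBd addr0 f_aug raddf0.
exact: (cone_cycle exB (esym dx')).
Qed.

(** The homology of the cone in degree 0 is the cokernel of i. *)
Lemma cone_exact_aug Y (p : nat_trans X' Y) : nt_epi eA -> exact_at i p ->
  exact_at (cd B 0) eB -> exact_at (cone_d 0) (p \on eB).
Proof.
move=> epiA exi exB a y; split=> [/exi[x ix] | [[x z] <-]] /=; last first.
  have -> : eB a (f 0 a x + cd B 0 a z) = i a (eA a x).
    by rewrite raddfD /= f_aug [X in _ + X](_ : _ = 0) ?addr0 //; apply/exB; exists z.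
  by apply/exi; exists (eA a x).
have [x' ex'] := epiA a x.
have /exB[z dz] : eB a (y - f 0 a x') = 0 by rewrite raddfB /= f_aug ex' ix subrr.
by exists (x', z); rewrite dz addrC subrK.
Qed.

End Cone.

Lemma cone_exact0 (A B : complex) (f : forall n, nat_trans (A n) (B n))
    (f_d : forall n a x, f n a (cd A n a x) = cd B n a (f n.+1 a x))
    X (eA : nat_trans (A 0%N) X) (eB : nat_trans (B 0%N) X) :
    (forall a x, eB a (f 0 a x) = eA a x) -> nt_epi eA ->
  exact_at (cd B 0) eB -> exact_deg (cone f_d) 0.
Proof.
move=> f_aug epiA exB a y; have [x ex] := epiA a (eB a y).
have /exB[z dz] : eB a (y - f 0 a x) = 0 by rewrite raddfB /= f_aug ex subrr.
by exists (x, z); rewrite /= dz addrC subrK.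
Qed.

Definition bdry Y (S : projres Y) n :
    nat_trans (S n) (if n is m.+1 then S m else Y) :=
  if n is m.+1 then prd S m else aug S.

Lemma bdry_exact Y (S : projres Y) n : exact_at (prd S n) (bdry S n).
Proof. by case: n => [|n]; [apply: pr_exact0 | apply: pr_exact]. Qed.

Arguments bdry_exact {Y} S n.

Lemma bdry_prd Y (S : projres Y) n a x : bdry S n a (prd S n a x) = 0.
Proof. by apply/(bdry_exact S n); exists x. Qed.
Arguments bdry_prd {Y} S n a x.

Section Comparison.
Variables (X X' : functor C) (Q : projres X) (Q' : projres X') (u : nat_trans X X').

(** The maps in degree n that can be lifted one degree further. *)
Definition liftable n : Type := {g : nat_trans (Q n) (Q' n) |
  forall a x, bdry Q' n a (g a (prd Q n a x)) = 0}.

Lemma lift_start : exists g : nat_trans (Q 0%N) (Q' 0%N),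
  forall a x, aug Q' a (g a x) = u a (aug Q a x).
Proof.
have [g eg] := pr_proj Q 0 _ _ _ (pr_epi Q') (u \on aug Q).
by exists g => a x; apply: nt_eqP eg a x.
Qed.

Lemma lift_step n (g : liftable n) : exists g' : liftable n.+1,
  forall a x, prd Q' n a (sval g' a x) = sval g a (prd Q n a x).
Proof.
case: g => g gd /=.
have [g' eg'] := projective_lift (w := g \on prd Q n) (pr_proj _ _) (bdry_exact Q' n) gd.
have g'd a x : bdry Q' n.+1 a (g' a (prd Q n.+1 a x)) = 0.
  by rewrite /= eg' /= -[prd Q n a _]/(bdry Q n.+1 a _) bdry_prd raddf0.
by exists (exist _ g' g'd).
Qed.

Lemma comparison_exists : exists f : forall n, nat_trans (Q n) (Q' n),
  (forall n a x, f n a (prd Q n a x) = prd Q' n a (f n.+1 a x)) /\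
  forall a x, aug Q' a (f 0 a x) = u a (aug Q a x).
Proof.
have [g0 eg0] := lift_start.
have g0d a x : bdry Q' 0 a (g0 a (prd Q 0 a x)) = 0.
  by rewrite /= eg0 -[aug Q]/(bdry Q 0) bdry_prd raddf0.
pose next n (g : liftable n) := projT1 (cid (lift_step g)).
pose fix F n : liftable n := if n is m.+1 then next m (F m) else exist _ g0 g0d.
exists (fun n => sval (F n)); split=> [n a x|]; last exact: eg0.
by rewrite /= /next; case: cid => g' /= ->.
Qed.

End Comparison.

Section TraceExactness.
Variable P : functor C.

(** Exactness of A / Tr A in degree n + 1, without forming the quotient. *)
Definition trace_exact (A : complex) n := forall b (x : A n.+1 b),
  cd A n b x \in trace_sub P (A n) b ->
  exists y, x - cd A n.+1 b y \in trace_sub P (A n.+1) b.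

(** The cone of a comparison map over the identity is contractible, hence stays
    exact modulo the trace; this transfers exactness modulo the trace between
    the two resolutions. *)
Lemma trace_exact_indep X (Q Q' : projres X) n :
  trace_exact (res_complex Q') n -> trace_exact (res_complex Q) n.
Proof.
move=> exQ' b x dx.
have [f [f_d f_aug]] := comparison_exists Q Q' (nt_id X).
(* f is a quasi-isomorphism, so its cone is an exact complex of projectives. *)
pose A := @cone (res_complex Q) (res_complex Q') f f_d.
have [||e [e' ee']] := @homotopy A n.+2 _ _ n.+1 (leqnn _).
- by move=> m _; apply: cone_projective => k _; apply: pr_proj.
- move=> [|[|m]] _.
  + exact: (@cone_exact0 (res_complex Q) (res_complex Q') f f_d _ _ _ f_aug
      (pr_epi Q) (pr_exact0 Q')).
  + apply: (@cone_exact1 (res_complex Q) (res_complex Q') f f_d _ _ _ _ _ f_aug) => //.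
      exact: (pr_exact0 Q).
      by move=> a y; apply: (bdry_prd Q' 0).
    exact: (pr_exact Q').
  + by apply: cone_exactS; apply: pr_exact.
have [|y hy] := exQ' b (f n.+1 b x).
  by rewrite /= -f_d; apply: trace_nt.
(* By the choice of y this is a cycle modulo the trace. *)
pose z : A n.+2 b := (x, - y).
have Dz : cd A n.+1 b z \in trace_sub P (A n.+1) b.
  by apply: trace_sumf; rewrite /= ?raddfN ?rpredN.
have := trace_nt (fst_nt _ _) (trace_nt e Dz).
have /(congr1 fst) := ee' b z; move: (e' b z) (e b _) => /= [w1 w2] v /= -> hv.
by exists (- w1); rewrite /= raddfN opprK addrAC addNr add0r.
Qed.

(** The piece of the long exact homology sequence of the functor A / Tr A that
    dimension shifting needs.  In the lowest degree the assumption on Q is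
    replaced by the absence of traces in X'. *)
Lemma trace_exact_cone X X' (i : nat_trans X X') (Q : projres X) (Q' : projres X')
    (f : forall n, nat_trans (Q n) (Q' n))
    (f_d : forall n a x, f n a (prd Q n a x) = prd Q' n a (f n.+1 a x)) n :
    (forall a x, aug Q' a (f 0 a x) = i a (aug Q a x)) ->
    (forall a x, i a x \in trace_sub P X' a -> x = 0) ->
    trace_exact (res_complex Q') n ->
    (if n is m.+1 then trace_exact (res_complex Q) m else True) ->
  trace_exact (@cone (res_complex Q) (res_complex Q') f f_d) n.
Proof.
move=> f_aug i_inj exQ' exQ b [x y] Dxy.
have fxy : f n b x + prd Q' n b y \in trace_sub P (Q' n) b.
  by case: n {exQ exQ'} x y Dxy => [|n] x y // /(trace_nt (snd_nt _ _)).
have [x' hx'] : exists x', x - prd Q n b x' \in trace_sub P (Q n) b.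
  case: n {exQ'} exQ x y Dxy fxy => [_|n exQ] x y Dxy fxy; last first.
    by apply: exQ; rewrite -rpredN; apply: (trace_nt (fst_nt _ _) Dxy).
  have /i_inj/(pr_exact0 Q)[x' <-] : i b (aug Q b x) \in trace_sub P X' b.
    have := trace_nt (aug Q') fxy.
    by rewrite raddfD /= f_aug -[aug Q']/(bdry Q' 0) bdry_prd addr0.
  by exists x'; rewrite subrr rpred0.
have [|y' hy'] := exQ' b (y + f n.+1 b x').
  have := rpredB fxy (trace_nt (f n) hx').
  by rewrite raddfB opprB addrC addrA subrK addrC /= f_d -raddfD; apply.
exists (- x', y'); apply: trace_sumf; rewrite /=.
  by rewrite (raddfN (prd Q n b)) opprK.
by rewrite (raddfN (f n.+1 b)) opprD opprK addrA.
Qed.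

End TraceExactness.

End Complexes.
Arguments bdry_exact {C Y} S n.
Arguments bdry_prd {C Y} S n a x.

(** * Coproducts of functors and existence of resolutions *)

Section DependentFunctions.
Variables (T : Type) (V : T -> zmodType).

Definition dfun : Type := forall t, V t.
HB.instance Definition _ := gen_eqMixin dfun.
HB.instance Definition _ := gen_choiceMixin dfun.

Lemma dfun_ext (f g : dfun) : (forall t, f t = g t) -> f = g.
Proof. exact: functional_extensionality_dep. Qed.

Definition dfun_add (f g : dfun) : dfun := fun t => f t + g t.
Definition dfun_opp (f : dfun) : dfun := fun t => - f t.

Fact dfun_addA : associative dfun_add.
Proof. by move=> f g h; apply: dfun_ext => t; apply: addrA. Qed.
Fact dfun_addC : commutative dfun_add.
Proof. by move=> f g; apply: dfun_ext => t; apply: addrC. Qed.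
Fact dfun_add0 : left_id (fun t => 0 : V t) dfun_add.
Proof. by move=> f; apply: dfun_ext => t; apply: add0r. Qed.
Fact dfun_addN : left_inverse (fun t => 0 : V t) dfun_opp dfun_add.
Proof. by move=> f; apply: dfun_ext => t; apply: addNr. Qed.

HB.instance Definition _ :=
  GRing.isZmodule.Build dfun dfun_addA dfun_addC dfun_add0 dfun_addN.

Definition fsupp_by (s : seq {classic T}) (f : dfun) : Prop :=
  forall t, f t != 0 -> (t : {classic T}) \in s.

Definition fsupp : {pred dfun} := [pred f | `[< exists s, fsupp_by s f >]].

Lemma fsupp_closed : zmod_closed fsupp.
Proof.
split=> [|f g]; first by apply/asboolP; exists [::] => t; rewrite eqxx.
move=> /asboolP[s hs] /asboolP[s' hs']; apply/asboolP; exists (s ++ s') => t.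
rewrite mem_cat; case: (eqVneq (f t) 0) => [f0|/hs-> //].
case: (eqVneq (g t) 0) => [g0|/hs'->]; last by rewrite orbT.
by rewrite -[(f - g) t]/(f t - g t) f0 g0 subr0 eqxx.
Qed.

HB.instance Definition _ := GRing.isZmodClosed.Build _ fsupp fsupp_closed.

(** The direct sum as the finitely supported dependent functions; the index
    type is arbitrary, so its equality is decided classically. *)
Definition dsum : zmodType := subz fsupp.

Lemma dsum_ext (f g : dsum) : (forall t, val f t = val g t) -> f = g.
Proof. by move=> fg; apply/val_inj/dfun_ext. Qed.

Definition sing_fun t (x : V t) : dfun := fun t' =>
  if pselect (t = t') is left e then eq_rect t V x t' e else 0.

Lemma sing_fun_supp t (x : V t) : sing_fun x \in fsupp.
Proof.
apply/asboolP; exists [:: t] => t'; rewrite /sing_fun.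
case: pselect => [e _|_]; last by rewrite eqxx.
by rewrite mem_seq1; apply/eqP/esym.
Qed.

Definition sing t (x : V t) : dsum := Sub (sing_fun x) (sing_fun_supp x).

Lemma sing_eq t (x : V t) : val (sing x) t = x.
Proof. by rewrite /= /sing_fun; case: pselect => // e; rewrite (Prop_irrelevance e erefl). Qed.

Lemma sing_neq t t' (x : V t) : t <> t' -> val (sing x) t' = 0.
Proof. by rewrite /= /sing_fun; case: pselect. Qed.

Lemma sing_additive t : zmod_morphism (@sing t).
Proof.
move=> x y; apply: dsum_ext => t' /=.
rewrite -[RHS]/(sing_fun x t' - sing_fun y t') /sing_fun.
by case: pselect => [e|]; [case: _ / e | rewrite subr0].
Qed.

HB.instance Definition _ t :=
  GRing.isZmodMorphism.Build (V t) dsum (@sing t) (@sing_additive t).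

Definition supp (f : dsum) : seq {classic T} :=
  undup (projT1 (cid (elimT (asboolP _) (valP f)))).

Lemma supp_uniq f : uniq (supp f).
Proof. exact: undup_uniq. Qed.

Lemma mem_supp f t : val f t != 0 -> (t : {classic T}) \in supp f.
Proof. by rewrite mem_undup; case: cid => s /= /(_ t). Qed.

Lemma dsum_sing (f : dsum) : f = \sum_(t <- supp f) sing (val f t).
Proof.
apply: dsum_ext => t; pose ev (g : dsum) : V t := val g t.
have evB : zmod_morphism ev by [].
pose evA := GRing.isZmodMorphism.Build dsum (V t) ev evB.
pose evM : {additive dsum -> V t} := HB.pack ev evA.
rewrite -[LHS]/(evM f) -[RHS]/(evM _) raddf_sum.
have [ts|] := boolP ((t : {classic T}) \in supp f).
  rewrite (bigD1_seq _ ts (supp_uniq f)) /= [X in X + _]sing_eq big1 ?addr0 //.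
  by move=> t' /eqP tt'; apply: sing_neq.
move=> ts; rewrite big_seq big1 => [|t' t's].
  by apply: contraNeq ts; apply: mem_supp.
by apply: sing_neq => e; rewrite -e t's in ts.
Qed.

Section MapOut.
Variables (W : zmodType) (u : forall t, {additive V t -> W}).

Definition dsum_out (f : dsum) : W := \sum_(t <- supp f) u t (val f t).

(** Additivity compares sums over the supports of different elements, so the
    value must not depend on the list that is summed over. *)
Lemma dsum_outE (f : dsum) (s : seq {classic T}) : uniq s -> fsupp_by s (val f) ->
  dsum_out f = \sum_(t <- s) u t (val f t).
Proof.
move=> us fs; pose nz (t : {classic T}) := val f t != 0.
have red r : \sum_(t <- r) u t (val f t) = \sum_(t <- filter nz r) u t (val f t).
  rewrite big_filter [LHS](bigID nz) /= [X in _ + X]big1 ?addr0 //.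
  by move=> t /negPn/eqP->; rewrite raddf0.
rewrite /dsum_out red [RHS]red; apply/perm_big/uniq_perm.
- exact/filter_uniq/supp_uniq.
- exact: filter_uniq.
move=> t; rewrite !mem_filter; apply/andb_id2l => nzt.
by rewrite mem_supp // fs.
Qed.

Lemma dsum_out_additive : zmod_morphism dsum_out.
Proof.
move=> f g; pose s := undup (supp f ++ supp g).
have us : uniq s := undup_uniq _.
have fs : fsupp_by s (val f) by move=> t /mem_supp h; rewrite mem_undup mem_cat h.
have gs : fsupp_by s (val g).
  by move=> t /mem_supp h; rewrite mem_undup mem_cat h orbT.
have fgs : fsupp_by s (val (f - g)).
  move=> t; apply: contraR => ts.
  rewrite -[val _ t]/(val f t - val g t).
  have /eqP-> : val f t == 0 by apply: contraNT ts => /fs.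
  by have /eqP-> : val g t == 0 by [apply: contraNT ts => /gs]; rewrite subr0.
rewrite !(dsum_outE us) // -sumrB; apply: eq_bigr => t _.
exact: raddfB.
Qed.

Lemma dsum_out_sing t (x : V t) : dsum_out (sing x) = u t x.
Proof.
rewrite (@dsum_outE _ [:: t]) // ?big_seq1 ?sing_eq // => t' h.
rewrite mem_seq1; apply/eqP; apply: contrapT => tt'.
by rewrite sing_neq ?eqxx // in h => e; case: tt'.
Qed.

End MapOut.

End DependentFunctions.

Section Coproduct.
Variables (C : preadditive) (T : Type).
Implicit Types (a b : C) (F G : T -> functor C).

Definition dsum_map_fun (V W : T -> zmodType) (u : forall t, {additive V t -> W t})
  (f : dsum V) : dfun W := fun t => u t (val f t).

Lemma dsum_map_supp (V W : T -> zmodType) (u : forall t, {additive V t -> W t}) (f : dsum V) :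
  @dsum_map_fun V W u f \in @fsupp T W.
Proof.
apply/asboolP; exists (supp f) => t; apply: contraR => /(contraNT (@mem_supp _ _ f t)).
by move=> /eqP f0; rewrite /dsum_map_fun f0 raddf0.
Qed.

Definition dsum_map (V W : T -> zmodType) (u : forall t, {additive V t -> W t}) (f : dsum V) : dsum W :=
  Sub (dsum_map_fun u f) (dsum_map_supp u f).

Program Definition coprod F : functor C :=
  @Functor C (fun a => dsum (fun t => F t a))
    (fun a b f x => dsum_map (fun t => fmap (F t) f : {additive _ -> _}) x) _ _ _ _.
Next Obligation. by move=> F a b f x y; apply: dsum_ext => t; apply: fmap_add. Qed.
Next Obligation. by move=> F a b f g x; apply: dsum_ext => t; apply: fmap_addl. Qed.
Next Obligation. by move=> F a x; apply: dsum_ext => t; apply: fmap_id. Qed.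
Next Obligation. by move=> F a b d g f x; apply: dsum_ext => t; apply: fmap_comp. Qed.

Program Definition coprod_inj F t : nat_trans (F t) (coprod F) :=
  @NatTrans _ (F t) (coprod F) (fun a x => sing (V := fun t => F t a) x) _ _.
Next Obligation. by move=> F t a; exact: (@sing_additive T (fun t => F t a) t). Qed.
Next Obligation.
move=> F t a b f x; apply: dsum_ext => t' /=; rewrite /dsum_map_fun /= /sing_fun.
by case: pselect => [e|_]; [case: _ / e | rewrite raddf0].
Qed.

Program Definition coprod_proj F t : nat_trans (coprod F) (F t) :=
  @NatTrans _ (coprod F) (F t) (fun a x => val x t) _ _.
Next Obligation. by []. Qed.
Next Obligation. by []. Qed.

Program Definition coprod_map F G (u : forall t, nat_trans (F t) (G t)) :
    nat_trans (coprod F) (coprod G) :=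
  @NatTrans _ (coprod F) (coprod G)
    (fun a x => dsum_map (fun t => u t a : {additive _ -> _}) x) _ _.
Next Obligation. by move=> F G u a x y; apply: dsum_ext => t; apply: nt_add. Qed.
Next Obligation. by move=> F G u a b f x; apply: dsum_ext => t; apply: nt_nat. Qed.

Program Definition coprod_out F (M : functor C) (u : forall t, nat_trans (F t) M) :
    nat_trans (coprod F) M :=
  @NatTrans _ (coprod F) M
    (fun a x => dsum_out (V := fun t => F t a) (fun t => u t a : {additive _ -> _}) x) _ _.
Next Obligation. by move=> F M u a; exact: (@dsum_out_additive T (fun t => F t a)). Qed.
Next Obligation.
move=> F M u a b f x.
have xs : fsupp_by (supp x) (val (fmap (coprod F) f x)).
  move=> t h; apply: mem_supp; apply: contraNneq h => h0.
  by rewrite /= /dsum_map_fun /= h0 raddf0.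
apply: (etrans (@dsum_outE T (fun t => F t b) (M b) _ _ (supp x) (supp_uniq x) xs)).
by rewrite raddf_sum; apply: eq_bigr => t _; rewrite /= nt_nat.
Qed.

Lemma coprod_out_inj F M (u : forall t, nat_trans (F t) M) t a x :
  coprod_out u a (coprod_inj F t a x) = u t a x.
Proof. exact: dsum_out_sing. Qed.

Lemma coprod_sum F a (x : coprod F a) :
  x = \sum_(t <- supp x) coprod_inj F t a (val x t).
Proof. exact: dsum_sing. Qed.

Lemma coprod_ext F M (u v : nat_trans (coprod F) M) :
  (forall t a x, u a (coprod_inj F t a x) = v a (coprod_inj F t a x)) -> u = v.
Proof.
move=> uv; apply: nt_ext => a x; rewrite (coprod_sum x).
rewrite (raddf_sum (u a)) (raddf_sum (v a)); apply: eq_bigr => t _.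
exact: uv.
Qed.

Lemma coprod_projective F : (forall t, projective (F t)) -> projective (coprod F).
Proof.
move=> pF M N e epi_e f.
have lift t := pF t _ _ _ epi_e (f \on coprod_inj F t).
exists (coprod_out (fun t => projT1 (cid (lift t)))); apply: coprod_ext => t a x.
rewrite -[LHS]/(e a (coprod_out _ a (coprod_inj F t a x))) coprod_out_inj.
case: cid => g /= eg; exact: nt_eqP eg a x.
Qed.

Lemma coprod_exact F G H (u : forall t, nat_trans (F t) (G t))
    (v : forall t, nat_trans (G t) (H t)) :
  (forall t, exact_at (u t) (v t)) -> exact_at (coprod_map u) (coprod_map v).
Proof.
move=> uv a y; split=> [vy|[x <-]]; last first.
  by apply: dsum_ext => t; apply/uv; exists (val x t).
have ex t : exists x, u t a x = val y t /\ (val y t = 0 -> x = 0).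
  have [y0|y0] := eqVneq (val y t) 0; first by exists 0; rewrite raddf0.
  have /uv[x ux] : v t a (val y t) = 0.
    exact: (congr1 (fun z : dsum _ => val z t) vy).
  by exists x; split=> // e; rewrite e eqxx in y0.
pose x t := projT1 (cid (ex t)).
have xP t : u t a (x t) = val y t /\ (val y t = 0 -> x t = 0) by rewrite /x; case: cid.
have xs : x \in @fsupp T (fun t => F t a).
  apply/asboolP; exists (supp y) => t h; apply: mem_supp.
  by apply: contraNneq h; have [_ +] := xP t => /[swap] -> ->.
by exists (Sub x xs); apply: dsum_ext => t; have [] := xP t.
Qed.

Lemma coprod_trace P F b (x : coprod F b) :
  (forall t, val x t \in trace_sub P (F t) b) <-> x \in trace_sub P (coprod F) b.
Proof.
split=> [h|]; first by rewrite (coprod_sum x) rpred_sum // => t _; apply: trace_nt.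
by move=> h t; apply: (trace_nt (coprod_proj F t) h).
Qed.

End Coproduct.

Section ProjectiveResolutions.
Variable C : preadditive.
Implicit Types (a b : C) (A B D M X : functor C).

Definition elements X : Type := {a : C & X a}.

Definition cover X : functor C := coprod (fun t : elements X => rep (tag t)).

Definition cover_map X : nat_trans (cover X) X :=
  coprod_out (fun t : elements X => yoneda (tagged t)).

Lemma cover_projective X : projective (cover X).
Proof. by apply: coprod_projective => t; apply: rep_projective. Qed.

Lemma cover_epi X : nt_epi (cover_map X).
Proof.
move=> a x; pose t : elements X := existT _ a x.
exists (coprod_inj (fun t : elements X => rep (tag t)) t a (idm a)).
by rewrite coprod_out_inj /= fmap_id.
Qed.

Fixpoint syzygy X n : functor C :=
  if n is m.+1 then kerf (cover_map (syzygy X m)) else X.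

Lemma splice_exact0 A B D (v : nat_trans A B) (p : nat_trans D (kerf v)) :
  nt_epi p -> exact_at (ker_incl v \on p) v.
Proof.
move=> epi_p a y; split=> [/ker_mem[z <-]|[x <-]]; last exact: ker_inclP.
by have [x <-] := epi_p a z; exists x.
Qed.

Lemma splice_exact A B D M (v : nat_trans A B) (w : nat_trans D (kerf v))
    (p : nat_trans M (kerf w)) :
  nt_epi p -> exact_at (ker_incl w \on p) (ker_incl v \on w).
Proof.
move=> epi_p a y; split=> [wy|/(splice_exact0 epi_p)]; last first.
  by move=> wy; rewrite -[LHS]/(ker_incl v a (w a y)) wy raddf0.
by apply/(splice_exact0 epi_p)/ker_incl_inj; rewrite [RHS]raddf0.
Qed.

Definition cover_resolution X : projres X :=
  @ProjRes _ X (fun n => cover (syzygy X n))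
    (fun n => ker_incl (cover_map (syzygy X n)) \on cover_map (syzygy X n.+1))
    (cover_map X) (fun n => @cover_projective _) (@cover_epi X)
    (splice_exact0 (@cover_epi (syzygy X 1)))
    (fun n => splice_exact (@cover_epi (syzygy X n.+2))).

End ProjectiveResolutions.

(** * From resolutions of the trace ideal to idempotency *)

Section ConeResolution.
Variables (C : preadditive) (X Y Z : functor C).
Variables (i : nat_trans X Y) (p : nat_trans Y Z).
Hypotheses (i_inj : forall a x, i a x = 0 -> x = 0) (ip : exact_at i p) (epi_p : nt_epi p).
Variables (Q : projres X) (S : projres Y) (f : forall n, nat_trans (Q n) (S n)).
Hypothesis f_d : forall n a x, f n a (prd Q n a x) = prd S n a (f n.+1 a x).
Hypothesis f_aug : forall a x, aug S a (f 0 a x) = i a (aug Q a x).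

Let K : complex C := @cone C (res_complex Q) (res_complex S) f f_d.

Lemma cone_res_projective n : projective (K n).
Proof. by apply: cone_projective => m _; apply: pr_proj. Qed.

Lemma cone_res_epi : nt_epi (p \on aug S).
Proof. by move=> a z; have [y <-] := @epi_p a z; have [s <-] := pr_epi S a y; exists s. Qed.

Lemma cone_res_exact0 : exact_at (cd K 0) (p \on aug S).
Proof.
exact: (cone_exact_aug (A := res_complex Q) (B := res_complex S) (f := f)
  f_aug (pr_epi Q) ip (pr_exact0 S)).
Qed.

Lemma cone_res_exact n : exact_at (cd K n.+1) (cd K n).
Proof.
case: n => [|n]; last by apply: cone_exactS; apply: pr_exact.
apply: (@cone_exact1 C (res_complex Q) (res_complex S) f f_d _ _ _ _ _ f_aug) => //.
- exact: (pr_exact0 Q).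
- by move=> a y; apply: (bdry_prd S 0).
exact: (pr_exact S).
Qed.

(** For an exact sequence 0 -> X -> Y -> Z -> 0, the cone of a lift of X -> Y
    to resolutions resolves Z. *)
Definition cone_res : projres Z :=
  @ProjRes C Z K (cd K) (p \on aug S) cone_res_projective cone_res_epi
    cone_res_exact0 cone_res_exact.

End ConeResolution.

Section Sufficiency.
Variables (C : preadditive) (c : C).
Local Notation P := (rep c).
Local Notation I := (trace_ideal (rep c)).
Implicit Types (a b : C) (X : functor C).

Program Definition ideal_incl a : nat_trans (ideal_functor I a) (rep a) :=
  @NatTrans _ (ideal_functor I a) (rep a) (fun b x => val x) _ _.
Next Obligation. by []. Qed.
Next Obligation. by []. Qed.

Lemma ideal_incl_exact a F (u : nat_trans F (ideal_functor I a)) : nt_epi u ->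
  exact_at (ideal_incl a \on u) (red_unit P (rep a)).
Proof.
move=> epi_u b h; split=> [/red_pi0 hI | [x <-]].
  by have [x ux] := epi_u b (Sub h hI); exists x; rewrite /= ux.
by apply/red_pi0; apply: (valP (u b x)).
Qed.

Section CoverResolution.
Variables (X : functor C) (Pr : forall a, projres (ideal_functor I a)).

Let a_ (t : elements X) : C := tag t.

(** The resolution of L / Tr L, for the cover L of X: since L is a coproduct of
    representables Hom(a, -), its trace is the coproduct of the I(a, -). *)
Definition cover_red_ob n : functor C :=
  if n is m.+1 then coprod (fun t => Pr (a_ t) m) else cover X.

Definition cover_red_d n : nat_trans (cover_red_ob n.+1) (cover_red_ob n) :=
  match n with
  | 0 => coprod_map (fun t => ideal_incl (a_ t) \on aug (Pr (a_ t)))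
  | m.+1 => coprod_map (fun t => prd (Pr (a_ t)) m)
  end.

Lemma cover_red_projective n : projective (cover_red_ob n).
Proof.
case: n => [|n]; first exact: cover_projective.
by apply: coprod_projective => t; apply: pr_proj.
Qed.

Lemma cover_red_exact0 : exact_at (cover_red_d 0) (red_unit P (cover X)).
Proof.
have ex : exact_at (cover_red_d 0) (coprod_map (fun t => red_unit P (rep (a_ t)))).
  by apply: coprod_exact => t; apply/ideal_incl_exact/pr_epi.
move=> b x; rewrite -ex; split=> [/red_pi0/coprod_trace h | h].
  by apply: dsum_ext => t; apply/red_pi0/h.
apply/red_pi0/coprod_trace => t; apply/red_pi0.
exact: (congr1 (fun z : dsum _ => val z t) h).
Qed.

Lemma cover_red_exact n : exact_at (cover_red_d n.+1) (cover_red_d n).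
Proof.
case: n => [|n]; apply: coprod_exact => t; last exact: pr_exact.
move=> b x; rewrite -(pr_exact0 (Pr (a_ t)) b x) /=.
by split=> [h | ->]; first exact: val_inj.
Qed.

Definition cover_red_res : projres (restr (quot_fun I) (reduce P (cover X))) :=
  @ProjRes C _ cover_red_ob cover_red_d (red_unit P (cover X)) cover_red_projective
    (@red_unit_epi _ _ _) cover_red_exact0 cover_red_exact.

End CoverResolution.

Variable k : enat.
Hypothesis I_PP : forall a, in_PP P k (ideal_functor I a).

(** One dimension shift: X is a quotient of L / Tr L, the terms of whose
    resolution are equal to their traces in the relevant degrees, by a functor
    that vanishes at c as well. *)
Lemma trace_exact_step n : leqe n k ->
    (if n is m.+1 then forall X, (forall x : X c, x = 0) ->
       forall Q : projres X, trace_exact P (res_complex Q) m else True) ->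
  forall X, (forall x : X c, x = 0) ->
  forall Q : projres X, trace_exact P (res_complex Q) n.
Proof.
move=> len IHn X X0 Q.
have [Pr PrP] : exists Pr : forall a, projres (ideal_functor I a),
    forall a m, leqe m k -> in_add P (Pr a m).
  have ex a := (I_PP a).2.
  by exists (fun a => projT1 (cid (ex a))) => a; case: cid => S [].
pose L := restr (quot_fun I) (reduce P (cover X)).
pose p : nat_trans L X := red_out (cover_map X) (rep_trace0 X0).
have epi_p : nt_epi p.
  move=> b x; have [y <-] := @cover_epi _ X b x.
  by exists (red_pi P y); apply: (red_out_pi (cover_map X) (rep_trace0 X0)).
pose S : projres L := cover_red_res X Pr.
have exS : trace_exact P (res_complex S) n.
  move=> b x _; exists 0; rewrite raddf0 subr0.
  by apply/coprod_trace => t; apply/in_add_trace/PrP.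
have ip : exact_at (ker_incl p) p.
  by move=> b y; split=> [/ker_mem //|[z <-]]; apply: ker_inclP.
have i_inj b x : ker_incl p b x = 0 -> x = 0.
  by move=> e; apply: ker_incl_inj; rewrite e raddf0.
have K0 (x : kerf p c) : x = 0 by apply: i_inj; apply: restr_rep_trace.
have [f [f_d f_aug]] := comparison_exists (cover_resolution (kerf p)) S (ker_incl p).
apply: (@trace_exact_indep _ P X Q (cone_res i_inj ip epi_p f_d f_aug)).
apply: (@trace_exact_cone _ P _ _ _ _ _ f f_d n f_aug _ exS).
  by move=> a x /restr_trace0/i_inj.
by case: n {len exS} IHn => // m IHm; apply: IHm.
Qed.

Lemma trace_exact_of_PP n : leqe n k -> forall X, (forall x : X c, x = 0) ->
  forall Q : projres X, trace_exact P (res_complex Q) n.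
Proof.
elim: n => [|n IHn] len; apply: trace_exact_step => //.
by apply: IHn; case: (k) len => // m; apply: ltnW.
Qed.

Section ExtIso.
Variables (F F' : functor (quot_cat I)) (Pr : projres F).
Variables (Q : projres (restr (quot_fun I) F)) (phi : comparison Pr Q).

Definition red_d n : nat_trans (reduce P (Q n.+1)) (reduce P (Q n)) :=
  red_lift (red_unit P (Q n) \on prd Q n).

Arguments red_d : simpl never.

Lemma red_dE n a x : red_d n a (red_pi P x) = red_pi P (prd Q n a x).
Proof. exact: red_liftE. Qed.

Lemma red_dd n a x : red_d n a (red_d n.+1 a x) = 0.
Proof.
have [y ->] := red_piP x.
by rewrite !red_dE -[prd Q n]/(bdry Q n.+1) bdry_prd raddf0.
Qed.

Definition red_complex : complex (quot_cat I) :=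
  @Complex (quot_cat I) (fun n => reduce P (Q n)) red_d red_dd.

Definition red_aug : nat_trans (red_complex 0%N) F := red_lift (aug Q).

Definition red_phi n : nat_trans (red_complex n) (res_complex Pr n) := red_lift (phi n).

Arguments red_phi : simpl never.

Lemma red_phiE n a x : red_phi n a (red_pi P x) = phi n a x.
Proof. exact: red_liftE. Qed.

Lemma red_phi_d n a x :
  red_phi n a (cd red_complex n a x) = cd (res_complex Pr) n a (red_phi n.+1 a x).
Proof.
have [y ->] := red_piP x; rewrite [cd _ _ _ _](@red_dE n a y) !red_phiE.
exact: nt_eqP (cmp_d phi n) a y.
Qed.

Lemma red_phi_aug a x : aug Pr a (red_phi 0 a x) = red_aug a x.
Proof.
have [y ->] := red_piP x; rewrite red_phiE red_liftE.
exact: nt_eqP (cmp_aug phi) a y.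
Qed.

Lemma red_aug_exact : exact_at (red_d 0) red_aug.
Proof.
move=> a x; have [y ->] := red_piP x; rewrite red_liftE.
split=> [/(pr_exact0 Q)[z <-] | [z]]; first by exists (red_pi P z); rewrite red_dE.
have [w ->] := red_piP z; rewrite red_dE -red_liftE => <-; rewrite red_liftE.
by apply/(pr_exact0 Q); exists w.
Qed.

Lemma red_complex_exact n : leqe n k -> exact_deg red_complex n.+1.
Proof.
move=> len a x; split=> [|[y <-]]; last exact: red_dd.
have [y ->] := red_piP x; rewrite [cd _ _ _ _](@red_dE n a y) => /red_pi0 dy.
have [z yz] := @trace_exact_of_PP n len (restr (quot_fun I) F) (@restr_rep_trace _ _ F) Q a y dy.
by exists (red_pi P z); rewrite [cd _ _ _ _](@red_dE n.+1 a z); apply/esym/red_piE.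
Qed.

Definition red_cone : complex (quot_cat I) :=
  @cone (quot_cat I) red_complex (res_complex Pr) red_phi red_phi_d.

Lemma red_cone_projective n : projective (red_cone n).
Proof.
apply: cone_projective => m _; last exact: pr_proj.
exact/reduce_projective/pr_proj.
Qed.

(** The bound is k + 2: passing to the cone raises the degree by one. *)
Lemma red_cone_exact n : leqe n (esucc (esucc k)) -> exact_deg red_cone n.
Proof.
case: n => [|[|n]] len.
- apply: (@cone_exact0 _ red_complex (res_complex Pr) red_phi red_phi_d _ _ _
    red_phi_aug _ (pr_exact0 Pr)).
  by move=> a y; have [x <-] := pr_epi Q a y; exists (red_pi P x); apply: red_liftE.
- apply: (@cone_exact1 _ red_complex (res_complex Pr) red_phi red_phi_d _ _ (nt_id F)
    _ _ red_phi_aug) => //.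
  + exact: red_aug_exact.
  + by move=> a x; apply: (bdry_prd Pr 0).
  exact: (pr_exact Pr).
apply: cone_exactS; last exact: (pr_exact Pr).
by apply: red_complex_exact; case: (k) len.
Qed.

Lemma leq_esucc i n : leqe i (esucc k) -> (n <= i.+1)%N -> leqe n (esucc (esucc k)).
Proof. by case: (k) => //= m lei len; apply: leq_trans len _; rewrite ltnS. Qed.

Lemma coboundary_of_transport i (f : subz (cocycle Pr F' i)) : leqe i (esucc k) ->
  transport phi f \in coboundary Q (restr (quot_fun I) F') i ->
  f \in coboundary Pr F' i.
Proof.
move=> lei /asboolP tf; apply/asboolP; case: f tf => f f0 /= tf.
suff: is_cobound (A := res_complex Pr) f.
  case: i {lei f0} f tf => [|i] f _ /=; first by move=> f0; apply: nt_ext.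
  by case=> g fg; exists g; apply: nt_ext.
apply: (@cone_hom_inj _ red_complex (res_complex Pr) red_phi red_phi_d i.+1 F').
- by move=> n _; apply: red_cone_projective.
- by move=> n /(leq_esucc lei); apply: red_cone_exact.
- exact: leqnSn.
- by move=> a y; apply: nt_eqP (eqP f0) a y.
case: i {lei f0} f tf => [|i] f tf.
  move=> a x; have [y ->] := red_piP x.
  exact: etrans (congr1 (f a) (@red_phiE 0 a y)) (nt_eqP tf a y).
have [g eg] := tf; exists (red_lift g) => a x; have [y ->] := red_piP x.
rewrite [cd _ _ _ _](@red_dE i a y) [RHS]red_liftE.
exact: etrans (congr1 (f a) (@red_phiE i.+1 a y)) (nt_eqP eg a y).
Qed.

Lemma transport_onto i (g : subz (cocycle Q (restr (quot_fun I) F') i)) :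
    leqe i (esucc k) ->
  exists f : subz (cocycle Pr F' i),
    g - transport phi f \in coboundary Q (restr (quot_fun I) F') i.
Proof.
move=> lei; case: g => g g0.
have [||a x|v [vd gv]] := @cone_hom_surj _ red_complex (res_complex Pr) red_phi red_phi_d
  i.+1 F' _ _ i (red_lift g) (leqnn _).
- by move=> n _; apply: red_cone_projective.
- by move=> n /(leq_esucc lei); apply: red_cone_exact.
- have [y ->] := red_piP x; rewrite [cd _ _ _ _](@red_dE i a y) [LHS]red_liftE.
  exact: nt_eqP (eqP g0) a y.
have v0 : v \in cocycle Pr F' i by apply/eqP/nt_ext => a y; apply: vd.
exists (Sub v v0); apply/asboolP.
have gvE a x : (red_lift g - v \on red_phi i) a (red_pi P x) = g a x - v a (phi i a x).
  by rewrite -[g a x](red_liftE g) -[phi i a x]red_phiE.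
case: i {lei} g g0 v vd gv v0 gvE => [|i] g g0 v vd gv v0 gvE /=.
  by apply: nt_ext => a x; apply: etrans (esym (gvE a x)) (gv a _).
have [u gu] := gv.
exists (restr_nt (quot_fun I) u \on red_unit P (Q i)); apply: nt_ext => a x.
apply: etrans (esym (gvE a x)) _; apply: etrans (gu a _) _.
by rewrite [cd _ _ _ _](@red_dE i a x).
Qed.

Lemma Ext_map_bijective i : leqe i (esucc k) ->
  bijective (Ext_map phi (Y := F') (i := i)).
Proof.
move=> lei.
have onto y : exists x, Ext_map phi (Y := F') (i := i) x = y.
  have [g ->] := Ext_classP y; have [f gf] := transport_onto g lei.
  by exists (Ext_class f); rewrite Ext_mapE; apply/esym/Ext_classE.
have inj : injective (Ext_map phi (Y := F') (i := i)).
  move=> x y; have [f ->] := Ext_classP x; have [g ->] := Ext_classP y.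
  rewrite !Ext_mapE => /Ext_classE; rewrite -transportB => /(coboundary_of_transport lei).
  by move=> /Ext_classE.
exists (fun y => projT1 (cid (onto y))) => [x|y]; last by case: cid.
by apply: inj; case: cid.
Qed.

End ExtIso.

Lemma idempotent_of_PP : idempotent_upto I (esucc k).
Proof. by move=> F F' i lei Pr Q phi; apply: Ext_map_bijective. Qed.

End Sufficiency.

(** * Weak cokernels from the duality *)

Section Cokernel.
Variables (C : preadditive) (F G : functor C) (u : nat_trans F G).
Implicit Types a b : C.

Definition im_pred a : {pred G a} := [pred y | `[< exists x, u a x = y >]].

Lemma im_closed a : zmod_closed (@im_pred a).
Proof.
split=> [|y z]; first by apply/asboolP; exists 0; rewrite raddf0.
move=> /asboolP[x <-] /asboolP[x' <-]; apply/asboolP; exists (x - x').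
by rewrite raddfB.
Qed.

HB.instance Definition _ a := GRing.isZmodClosed.Build _ (@im_pred a) (im_closed a).

Definition im_sub a : zmodClosed (G a) := @im_pred a.

Definition cok_ob a : zmodType := {ideal_quot (im_sub a)}.
Definition cok_pi a (y : G a) : cok_ob a := \pi_({ideal_quot (im_sub a)}) y.

Lemma cok_piE a (y z : G a) : cok_pi y = cok_pi z <-> exists x, u a x = y - z.
Proof.
rewrite /cok_pi; split=> [/eqP|ux]; first by rewrite -Quotient.idealrBE => /asboolP.
by apply/eqP; rewrite -Quotient.idealrBE; apply/asboolP.
Qed.

Lemma cok_piP a (x : cok_ob a) : exists y, x = cok_pi y.
Proof. by exists (repr x); rewrite /cok_pi reprK. Qed.

Lemma cok_piB a : zmod_morphism (@cok_pi a).
Proof. by move=> x y; rewrite /cok_pi raddfB. Qed.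

HB.instance Definition _ a :=
  GRing.isZmodMorphism.Build (G a) (cok_ob a) (@cok_pi a) (@cok_piB a).

Lemma cok_repr a (y : G a) : exists x, u a x = repr (cok_pi y) - y.
Proof. by apply/cok_piE; rewrite /cok_pi reprK. Qed.

Section CokOut.
Variables (M : functor C) (v : nat_trans G M).
Hypothesis vu : forall a x, v a (u a x) = 0.

Lemma cok_out_pi a (y : G a) : v a (repr (cok_pi y)) = v a y.
Proof. by have [x ux] := cok_repr y; apply: subr0_eq; rewrite -raddfB /= -ux vu. Qed.

End CokOut.

Definition cok_map a b (f : hom a b) (x : cok_ob a) : cok_ob b :=
  cok_pi (fmap G f (repr x)).

Lemma cok_map_pi a b (f : hom a b) (y : G a) :
  cok_map f (cok_pi y) = cok_pi (fmap G f y).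
Proof.
have [x ux] := cok_repr y; apply/cok_piE; exists (fmap F f x).
by rewrite nt_nat ux raddfB.
Qed.

Program Definition cokf : functor C := @Functor C cok_ob cok_map _ _ _ _.
Next Obligation.
move=> a b f x y; have [x' ->] := cok_piP x; have [y' ->] := cok_piP y.
by rewrite -raddfB !cok_map_pi !raddfB.
Qed.
Next Obligation.
move=> a b f g x; have [y ->] := cok_piP x.
by rewrite !cok_map_pi fmap_addl raddfB.
Qed.
Next Obligation. by move=> a x; have [y ->] := cok_piP x; rewrite cok_map_pi fmap_id. Qed.
Next Obligation.
by move=> a b d g f x; have [y ->] := cok_piP x; rewrite !cok_map_pi fmap_comp.
Qed.

Program Definition cok_proj : nat_trans G cokf := @NatTrans _ G cokf cok_pi _ _.
Next Obligation. exact: cok_piB. Qed.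
Next Obligation. by move=> a b f x; rewrite /= cok_map_pi. Qed.

Program Definition cok_out M (v : nat_trans G M) (vu : forall a x, v a (u a x) = 0) :
    nat_trans cokf M :=
  @NatTrans _ cokf M (fun a x => v a (repr x)) _ _.
Next Obligation.
move=> M v vu a x y; have [x' ->] := cok_piP x; have [y' ->] := cok_piP y.
by rewrite -raddfB !cok_out_pi // raddfB.
Qed.
Next Obligation.
move=> M v vu a b f x; have [y ->] := cok_piP x.
by rewrite /= cok_map_pi !cok_out_pi // nt_nat.
Qed.

Lemma cok_outE M (v : nat_trans G M) (vu : forall a x, v a (u a x) = 0) a y :
  cok_out vu a (cok_proj a y) = v a y.
Proof. exact: cok_out_pi. Qed.

(** Lift a cover of F to the cover of G and add it to the relations of G; a
    biproduct turns the two sets of relations into a single representable. *)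
Lemma cok_fin_pres : has_biproducts C -> fin_pres F -> fin_pres G -> fin_pres cokf.
Proof.
move=> biprod [a' [_ [_ [e' [epi_e' _]]]]] [a [b [d [e [epi_e de]]]]].
have [h eh] := epi_e a' (u a' (e' a' (idm a'))).
have [s [i1 [i2 [p1 [p2 [p11 p22 p12 p21 _]]]]]] := biprod b a'.
pose d0 := d b (idm b).
have dE x (g : hom b x) : d x g = g \oc d0 by rewrite yonedaE.
have eE x (g : hom a' x) : e x (g \oc h) = u x (e' x g).
  by rewrite -[g \oc h]/(fmap (rep a) g h) nt_nat eh -!nt_nat /= compm1.
exists a, s, (rep_precomp (i1 \oc d0 + i2 \oc h)), (cok_proj \on e); split.
  by move=> x y; have [z ->] := cok_piP y; have [g <-] := epi_e x z; exists g.
move=> x g; split; last first.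
  case=> g' <- /=; rewrite -(raddf0 (@cok_pi x)); apply/cok_piE.
  rewrite subr0 compDr !compA raddfD /= eE.
  rewrite -[(g' \oc i1) \oc d0]dE [X in X + _](_ : _ = 0) ?add0r; last first.
    by apply/de; exists (g' \oc i1).
  by exists (e' x (g' \oc i2)).
rewrite /= -(raddf0 (@cok_pi x)) => /cok_piE[n]; rewrite subr0.
have [g' <-] := epi_e' x n; rewrite -eE => eg.
have /de[g'' dg] : e x (g - g' \oc h) = 0 by rewrite raddfB /= eg subrr.
exists (g'' \oc p1 + g' \oc p2).
rewrite /= compDr !compDl -!compA !(compA p1) !(compA p2) p11 p12 p21 p22.
by rewrite !comp1m !comp0l !comp0r addr0 add0r -dE dg subrK.
Qed.

End Cokernel.

Lemma rep_fin_pres (C : preadditive) : has_zero C -> forall a : C, fin_pres (rep a).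
Proof.
move=> [z z0] a; exists a, z, 0, (nt_id _); split; first by move=> b y; exists y.
move=> b y; split=> [/= ->|[x <-] //]; by exists 0.
Qed.

Section WeakCokernels.
Variables (R : comPzRingType) (C : lincat R) (E : lmodType R).
Implicit Types a b x y z w : C.

Lemma opcat_biproducts : has_biproducts C -> has_biproducts (opcat C).
Proof.
move=> biprod a b; have [s [i1 [i2 [p1 [p2 [p11 p22 p12 p21 ip]]]]]] := biprod a b.
by exists s, p1, p2, i1, i2; split.
Qed.

(** In terms of functors: Hom(z, -) covers the kernel of
    Hom(y, -) -> Hom(x, -). *)
Definition weak_cokernel x y z (f : @hom C x y) (g : @hom C y z) : Prop :=
  forall w (h : @hom C y w), h \oc f = 0 <-> exists h' : @hom C z w, h = h' \oc g.

(** The cokernel over the opposite category of the dual of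
    Hom(y, -) -> Hom(x, -) is finitely presented, hence dual to some K with a
    map i : K -> Hom(y, -), and a cover of K by a representable gives g.  That
    i is onto the kernel follows from Yoneda and full faithfulness: if h f = 0,
    then the dual of the map Hom(w, -) -> Hom(y, -) of h factors through the
    cokernel, and undoing the duality factors that map through i. *)
Lemma weak_cokernel_exists : additive_cat C -> dualizing C E ->
  forall x y (f : @hom C x y), exists z (g : @hom C y z), weak_cokernel f g.
Proof.
move=> [zeroC biC] [D_fp D_ff D_es] x y f.
have repfp a : fin_pres (@rep C a) by apply: rep_fin_pres.
have D_inj (M N : functor C) : fin_pres M -> fin_pres N ->
    injective (@dual_nt R C E M N) by move=> hM hN; apply/bij_inj/D_ff.
have D_comp (M N K : functor C) (v : nat_trans N K) (u : nat_trans M N) b h :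
    dual_nt E (v \on u) b h = dual_nt E u b (dual_nt E v b h).
  exact: lin_ext.
pose Df := dual_nt E (rep_precomp f).
have [K [K_fp [t [t' [_ tt']]]]] : exists K : functor C,
    fin_pres K /\ nt_iso (dual E K) (cokf Df).
  by apply/D_es/cok_fin_pres; [apply: opcat_biproducts | apply: D_fp | apply: D_fp].
have [Dinv _ DinvK] := D_ff _ _ K_fp (repfp y).
pose i := Dinv (t' \on cok_proj Df).
have Di : dual_nt E i = t' \on cok_proj Df by apply: DinvK.
have fi : rep_precomp f \on i = 0.
  apply: (D_inj _ _ K_fp (repfp x)); apply: nt_ext => b h.
  rewrite D_comp Di /= -[X in t' b X](_ : 0 = _).
    rewrite raddf0; apply: lin_ext => m /=; rewrite /value_nt /=.
    by rewrite raddf0.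
  rewrite -(raddf0 (@cok_pi _ _ _ Df b)); apply/cok_piE.
  by exists (- h); rewrite raddfN /= sub0r.
have [z [_ [_ [e [epi_e _]]]]] := K_fp.
exists z, (i z (e z (idm z))) => w h; split=> [hf | [h' ->]]; last first.
  have gf : i z (e z (idm z)) \oc f = 0 := nt_eqP fi z _.
  by rewrite -compA gf comp0r.
have vf b m : dual_nt E (rep_precomp h) b (Df b m) = 0.
  apply: lin_ext => g; have ghf : (g \oc h) \oc f = 0 by rewrite -compA hf comp0r.
  exact: etrans (congr1 (m : {linear _ -> _}) ghf) (raddf0 _).
pose h_ := @cok_out (opcat C) _ _ Df _ (dual_nt E (rep_precomp h)) vf.
have [Dinv' _ Dinv'K] := D_ff _ _ (repfp w) K_fp.
pose w' := Dinv' (h_ \on t).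
have Dw' : dual_nt E w' = h_ \on t by apply: Dinv'K.
have iw : i \on w' = rep_precomp h.
  apply: (D_inj _ _ (repfp w) (repfp y)); apply: nt_ext => b m.
  rewrite D_comp Di Dw' -[LHS]/(h_ b ((t \on t') b (cok_proj Df b m))) tt'.
  exact: (@cok_outE (opcat C) _ _ Df _ _ vf).
have [h' eh'] := epi_e w (w' w (idm w)).
exists h'; rewrite -[LHS]comp1m -[LHS]/(rep_precomp h w (idm w)) -iw.
by rewrite -[LHS]/(i w (w' w (idm w))) -eh' yonedaE nt_nat.
Qed.

End WeakCokernels.

(** * From idempotency to resolutions of the trace ideal *)

Section Powers.
Variables (C : preadditive) (c : C).
Implicit Types a b x y z w : C.

Lemma power_object n : additive_cat C ->
  exists (s : C) (i : 'I_n -> hom c s) (p : 'I_n -> hom s c),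
    (forall k l, p k \oc i l = if k == l then idm c else 0) /\
    \sum_k i k \oc p k = idm s.
Proof.
move=> [[z z0] biC]; elim: n => [|n [s [i [p [pi ip]]]]].
  exists z, (fun _ => 0), (fun _ => 0); split=> [[]//|].
  by rewrite big_ord0; apply: (z0 z).1.
have [s' [i1 [i2 [p1 [p2 [p11 p22 p12 p21 ip']]]]]] := biC c s.
exists s', (fun k => if unlift ord0 k is Some l then i2 \oc i l else i1),
  (fun k => if unlift ord0 k is Some l then p l \oc p2 else p1); split.
  move=> k l; case: (unliftP ord0 k) => [k'|] ->; case: (unliftP ord0 l) => [l'|] ->.
  - rewrite (inj_eq lift_inj) -pi compA -[_ \oc i2]compA p22.
    by rewrite compm1.
  - by rewrite -compA p21 comp0r.
  - by rewrite compA p12 comp0l.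
  - by rewrite p11 eqxx.
rewrite big_ord_recl unlift_none -[RHS]ip'; congr (_ + _).
under eq_bigr => k _ do rewrite liftK -compA [i k \oc _]compA.
by rewrite -comp_sumr -comp_suml ip comp1m.
Qed.

(** Precomposition with the i k and with the p k splits Hom(s, -) off the power
    of Hom(c, -). *)
Lemma power_in_add n s (i : 'I_n -> hom c s) (p : 'I_n -> hom s c) :
  \sum_k i k \oc p k = idm s -> in_add (rep c) (rep s).
Proof.
move=> ip.
have split_add a : zmod_morphism (fun h : rep s a => [ffun k => h \oc i k] : power (rep c) n a).
  by move=> x y; apply/ffunP => k; rewrite !ffunE compBl.
have split_nat a b (f : hom a b) (h : rep s a) :
    [ffun k => fmap (rep s) f h \oc i k] = fmap (power (rep c) n) f [ffun k => h \oc i k].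
  by apply/ffunP => k; rewrite !ffunE /= compA.
have join_add a : zmod_morphism (fun y : power (rep c) n a => \sum_k y k \oc p k : rep s a).
  by move=> x y; rewrite -sumrB; apply: eq_bigr => k _; rewrite !ffunE compBl.
have join_nat a b (f : hom a b) (y : power (rep c) n a) :
    \sum_k fmap (power (rep c) n) f y k \oc p k = fmap (rep s) f (\sum_k y k \oc p k).
  by rewrite raddf_sum; apply: eq_bigr => k _; rewrite ffunE /= compA.
exists n, (NatTrans split_add split_nat), (NatTrans join_add join_nat).
apply: nt_ext => a h /=.
under eq_bigr => k _ do rewrite ffunE -compA.
by rewrite -comp_sumr ip compm1.
Qed.

End Powers.

Section Approximation.
Variables (R : comPzRingType) (C : lincat R) (E : lmodType R) (c : C).
Hypotheses (C_variety : homfinite_variety C) (C_dual : dualizing C E).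
Local Notation P := (@rep C c).
Local Notation I := (@trace_ideal C (@rep C c)).
Implicit Types a b x y z w : C.

(** The kernel of Hom(y, -) -> Hom(x, -) is generated by Hom(c, -). *)
Definition trace_generated x y (f : @hom C x y) : Prop :=
  forall w (h : @hom C y w), h \oc f = 0 ->
  exists n (t : 'I_n -> @hom C c w) (v : 'I_n -> @hom C y c),
    (forall l, v l \oc f = 0) /\ h = \sum_l t l \oc v l.

(** If the kernel is generated by Hom(c, -), a weak cokernel g0 is itself a sum
    of maps through c whose second factors v kill f; these v, taken together as
    a map to a power of c, again form a weak cokernel. *)
Lemma adapted_cokernel x y (f : @hom C x y) : exists z (g : @hom C y z),
  weak_cokernel f g /\ (trace_generated f -> in_add P (rep z)).
Proof.
have [addC _ _] := C_variety.
have [z0 [g0 fg0]] := weak_cokernel_exists addC C_dual f.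
have [gen|ngen] := pselect (trace_generated f); last by exists z0, g0.
have g0f : g0 \oc f = 0 by apply/fg0; exists (idm z0); rewrite comp1m.
have [n [t [v [vf g0E]]]] := gen _ _ g0f.
have [z [i [p [pi ip]]]] := power_object c n addC.
exists z, (\sum_l i l \oc v l); split; last by move=> _; apply: power_in_add ip.
have pg l : p l \oc (\sum_l i l \oc v l) = v l.
  rewrite comp_sumr (bigD1 l) // big1 => [|l' /negPf ll'].
    by rewrite [LHS]addr0 compA pi eqxx comp1m.
  by rewrite compA pi eq_sym ll' comp0l.
move=> w h; split=> [/fg0[h' ->]|[h' ->]].
  exists (\sum_l (h' \oc t l) \oc p l).
  rewrite comp_suml g0E comp_sumr; apply: eq_bigr => l _.
  by rewrite -[RHS]compA pg compA.
by rewrite -compA comp_suml big1 ?comp0r // => l _; rewrite -compA vf comp0r.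
Qed.

(** The generators of the module Hom(a, c), taken together as a map to a power
    of c, give a map through which every map a -> c factors. *)
Lemma trace_approximation a : exists b (f : @hom C a b), in_add P (rep b) /\
  forall w (h : @hom C a w), h \in I a w <-> exists h' : @hom C b w, h = h' \oc f.
Proof.
have [addC _ fgC] := C_variety.
have [n [g gP]] := fgC a c.
have [s [i [p [pi ip]]]] := power_object c n addC.
pose f : @hom C a s := \sum_l i l \oc (g l : @hom C a c).
have pf l : p l \oc f = g l.
  rewrite comp_sumr (bigD1 l) // big1 => [|l' /negPf ll'].
    by rewrite [LHS]addr0 compA pi eqxx comp1m.
  by rewrite compA pi eq_sym ll' comp0l.
exists s, f; split; first exact: power_in_add ip.
move=> w h; split=> [/rep_traceP[m [y [z ->]]] | [h' ->]]; last first.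
  apply/rep_traceP; exists n, (fun l => h' \oc i l), g.
  by rewrite comp_sumr; apply: eq_bigr => l _; rewrite compA.
have zf l : exists q : @hom C s c, z l = q \oc f.
  have [r zl] := gP (z l).
  exists (\sum_l (r l *: (p l : lhom s c) : @hom C s c)).
  rewrite zl comp_suml; apply: eq_bigr => j _.
  by rewrite -(pf j) -[RHS]/(lcomp _ _) lcompZl.
exists (\sum_l y l \oc projT1 (cid (zf l))).
rewrite comp_suml; apply: eq_bigr => l _; rewrite -compA.
by case: cid => q /= ->.
Qed.

Record arrow := Arrow { src : C; tgt : C; arr : @hom C src tgt }.

Lemma next_exists (s : arrow) : exists s' : {z : C & @hom C (tgt s) z},
  weak_cokernel (arr s) (tagged s') /\
  (trace_generated (arr s) -> in_add P (rep (tag s'))).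
Proof. by have [z [g h]] := adapted_cokernel (arr s); exists (existT _ z g). Qed.

Definition next_arrow (s : arrow) : arrow := Arrow (tagged (projT1 (cid (next_exists s)))).

Lemma next_cokernel s : weak_cokernel (arr s) (arr (next_arrow s)).
Proof. by rewrite /next_arrow /=; case: cid => s' []. Qed.

Lemma next_in_add s : trace_generated (arr s) -> in_add P (rep (tgt (next_arrow s))).
Proof. by rewrite /next_arrow /=; case: cid => s' []. Qed.

Section Resolution.
Variables (a : C) (b : C) (f : @hom C a b).
Hypothesis b_add : in_add P (rep b).
Hypothesis fP :
  forall w (h : @hom C a w), h \in I a w <-> exists h' : @hom C b w, h = h' \oc f.

Fixpoint arrow_seq n : arrow := if n is m.+1 then next_arrow (arrow_seq m) else Arrow f.

(** The resolution Hom(a, -) <- Hom(b, -) <- ... obtained from the weak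
    cokernels.  It resolves Hom(a, -) / I(a, -), and without its first term it
    resolves I(a, -). *)
Definition rseq_ob n : functor C := rep (src (arrow_seq n)).
Definition rseq_d n : nat_trans (rseq_ob n.+1) (rseq_ob n) := rep_precomp (arr (arrow_seq n)).

Lemma rseq_exact n : exact_at (rseq_d n.+1) (rseq_d n).
Proof.
move=> w h; split=> [/(@next_cokernel (arrow_seq n) w h)[h' ->] | [h' eh]]; first by exists h'.
by apply/(@next_cokernel (arrow_seq n) w h); exists h'.
Qed.

Arguments rseq_exact n : clear implicits.

Lemma comp_in_ideal w (h : rep b w) : h \oc f \in I a w.
Proof. by apply/fP; exists h. Qed.

Program Definition ideal_cover : nat_trans (rep b) (ideal_functor I a) :=
  @NatTrans _ (rep b) (ideal_functor I a)
    (fun w h => Sub (h \oc f) (comp_in_ideal h)) _ _.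
Next Obligation. by move=> w h h'; apply: val_inj; apply: compBl. Qed.
Next Obligation. by move=> w w' g h; apply: val_inj; apply/esym/compA. Qed.

Lemma ideal_cover_epi : nt_epi ideal_cover.
Proof.
move=> w [h hI]; have /fP[h' eh] := hI; exists h'.
by apply: val_inj; apply: esym eh.
Qed.

Lemma ideal_cover_exact : exact_at (rseq_d 1) ideal_cover.
Proof.
move=> w h; rewrite -(rseq_exact 0 w h).
by split=> [/(congr1 val) // | h0]; apply: val_inj.
Qed.

Definition ideal_res : projres (ideal_functor I a) :=
  @ProjRes _ _ (fun n => rseq_ob n.+1) (fun n => rseq_d n.+1) ideal_cover
    (fun n => @rep_projective _ _) ideal_cover_epi ideal_cover_exact
    (fun n => rseq_exact n.+1).

Definition quot_rep : functor (quot_cat I) := @rep (quot_cat I) a.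

Program Definition quot_proj : nat_trans (rep a) (restr (quot_fun I) quot_rep) :=
  @NatTrans _ (rep a) (restr (quot_fun I) quot_rep) (fun w h => qpi I h) _ _.
Next Obligation. by move=> w; apply: qpiB. Qed.
Next Obligation. by move=> w w' g h; apply/esym/qcomp_pi. Qed.

Lemma quot_proj_epi : nt_epi quot_proj.
Proof. by move=> w x; have [h ->] := qpiP x; exists h. Qed.

Lemma quot_proj_exact : exact_at (rseq_d 0) quot_proj.
Proof.
move=> w h; have -> : quot_proj w h = 0 <-> h \in I a w.
  rewrite -[0](raddf0 (\pi_({ideal_quot (I a w)}))).
  by rewrite -[in X in _ <-> X](subr0 h); apply: qpiE.
rewrite fP; split=> [[h' ->] | [h' <-]]; by exists h'.
Qed.

Arguments quot_proj_exact : clear implicits.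

Definition quot_rep_res_C : projres (restr (quot_fun I) quot_rep) :=
  @ProjRes _ _ rseq_ob rseq_d quot_proj (fun n => @rep_projective _ _)
    quot_proj_epi quot_proj_exact rseq_exact.

Definition quot_rep_ob n : functor (quot_cat I) :=
  if n is m.+1 then zerof _ else quot_rep.

Lemma quot_rep_ob_projective n : projective (quot_rep_ob n).
Proof. by case: n => [|n]; [apply: rep_projective | apply: zerof_projective]. Qed.

Lemma zerof_eq (D : preadditive) (d : D) (x y : zerof D d) : x = y.
Proof. by rewrite (thinmx0 x) (thinmx0 y). Qed.

(** Hom(a, -) / I(a, -) is representable over C/I, so it is its own projective
    resolution there and has no higher Ext groups. *)
Program Definition quot_rep_res : projres quot_rep :=
  @ProjRes _ _ quot_rep_ob (fun n => 0) (nt_id quot_rep) quot_rep_ob_projective _ _ _.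
Next Obligation. by move=> w x; exists x. Qed.
Next Obligation.
by move=> w x; split=> [/= ->|[y <-] //]; exists 0.
Qed.
Next Obligation.
by move=> n w x; split=> // _; exists 0; apply: zerof_eq.
Qed.

Definition quot_rep_cmp_map n : nat_trans (rseq_ob n) (restr (quot_fun I) (quot_rep_ob n)) :=
  if n is m.+1 then 0 else quot_proj.

Program Definition quot_rep_cmp : comparison quot_rep_res quot_rep_res_C :=
  @Comparison _ _ _ _ _ _ quot_rep_cmp_map _ _.
Next Obligation.
case=> [|n]; apply: nt_ext => w h; last exact: (@zerof_eq (quot_cat I) w).
rewrite -[RHS]/(0 : quot_rep w).
by apply/(quot_proj_exact w (rseq_d 0 w h)); exists h.
Qed.
Next Obligation. exact: nt_ext. Qed.

Variable k : enat.
Hypothesis I_idem : idempotent_upto I (esucc k).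

(** The vanishing of Ext over C, transported from C/I by idempotency. *)
Lemma rseq_cocycle n (Y : functor (quot_cat I))
    (g : nat_trans (rseq_ob n.+1) (restr (quot_fun I) Y)) : leqe n k ->
    (forall w h, g w (rseq_d n.+1 w h) = 0) ->
  exists g' : nat_trans (rseq_ob n) (restr (quot_fun I) Y), g = g' \on rseq_d n.
Proof.
move=> len gd.
have gP : g \in cocycle quot_rep_res_C (restr (quot_fun I) Y) n.+1.
  by apply/eqP/nt_ext.
have len1 : leqe n.+1 (esucc k) by case: (k) len.
have [inv _ invK] := @I_idem quot_rep Y n.+1 len1 _ _ quot_rep_cmp.
pose xg : subz (cocycle quot_rep_res_C (restr (quot_fun I) Y) n.+1) := Sub g gP.
have := invK (Ext_class xg); have [z ->] := Ext_classP (inv (Ext_class xg)).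
rewrite Ext_mapE => /esym/Ext_classE /asboolP /= [g' eg']; exists g'.
rewrite -eg'; apply: nt_ext => w h; rewrite -[RHS]/(g w h - val z w 0).
by rewrite raddf0 subr0.
Qed.

(** For the kernel K of the differential in degree n + 1, the composite of the
    next term with K -> K / Tr K is a cocycle, hence factors through the term in
    degree n + 1.  That term is in add(P), so it has no nonzero map to a functor
    that vanishes at c, and K = Tr K. *)
Lemma rseq_trace_generated n : leqe n.+1 k -> in_add P (rseq_ob n.+1) ->
  trace_generated (arr (arrow_seq n)).
Proof.
move=> len addn w h hf.
pose K := kerf (rseq_d n).
pose Y := reduce P K.
have dd b' u : rseq_d n b' (rseq_d n.+1 b' u) = 0 by apply/rseq_exact; exists u.
pose p : nat_trans (rseq_ob n.+2) K := ker_lift dd.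
pose g : nat_trans (rseq_ob n.+2) (restr (quot_fun I) Y) := red_unit P K \on p.
have gd b' u : g b' (rseq_d n.+2 b' u) = 0.
  rewrite -[LHS]/(red_pi P (p b' (rseq_d n.+2 b' u))).
  rewrite (_ : p b' _ = 0) ?raddf0 //; apply: ker_incl_inj.
  by rewrite raddf0; apply/(rseq_exact n.+1); exists u.
have [g' eg] := rseq_cocycle len gd.
have [x0 ex0] : exists x0 : K w, ker_incl _ w x0 = h by apply: ker_mem.
have /(rseq_exact n w h)[h' eh'] : rseq_d n w h = 0 by [].
have ph' : p w h' = x0 by apply: ker_incl_inj; rewrite ex0.
have : red_pi P x0 = 0.
  rewrite -ph' -[LHS]/(g w h') eg.
  apply: (@restr_trace0 _ _ Y).
  exact: (trace_nt g' (in_add_trace addn (rseq_d n.+1 w h'))).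
move=> /red_pi0/rep_traceP[m [y [z ex]]].
exists m, y, (fun l => ker_incl _ c (z l)); split=> [l|].
  exact: (ker_inclP (z l)).
by rewrite -ex0 ex (raddf_sum (ker_incl (rseq_d n) w)); apply: eq_bigr.
Qed.

Lemma rseq_in_add n : leqe n k -> in_add P (rseq_ob n.+1).
Proof.
elim: n => [|n IHn] len //.
have len' : leqe n k by case: (k) len => // m; apply: ltnW.
exact/next_in_add/rseq_trace_generated/IHn.
Qed.

End Resolution.

Lemma PP_of_idempotent k : idempotent_upto I (esucc k) ->
  forall a, in_PP P k (ideal_functor I a).
Proof.
move=> I_idem a; have [b [f [b_add fP]]] := trace_approximation a.
have repfp x : fin_pres (@rep C x) by apply: rep_fin_pres; have [[]] := C_variety.
split.
  exists (src (arrow_seq f 1)), (src (arrow_seq f 2)), (rseq_d f 1), (ideal_cover fP).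
  by split; [apply: ideal_cover_epi | apply: ideal_cover_exact].
exists (ideal_res fP); split=> [n|n len]; first exact: repfp.
exact: (rseq_in_add b_add fP I_idem).
Qed.

End Approximation.

Theorem proposition6p17 (R : comPzRingType) (E : lmodType R)
    (j : {linear ring_top R -> E}) (C : lincat R) (c : C) (k : enat)
    (R_artin : artinian R) (E_envelope : injective_envelope j)
    (C_variety : homfinite_variety C) (C_dualizing : dualizing C E)
    (k_ge1 : leqe 1 k) :
  idempotent_upto (trace_ideal (rep c)) (esucc k) <->
  forall c' : C, in_PP (rep c) k (ideal_functor (trace_ideal (rep c)) c').
Proof.
split=> [I_idem c' | I_PP]; last exact: idempotent_of_PP.
exact: PP_of_idempotent C_variety C_dualizing _ I_idem c'.
Qed.
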